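(* Let $\theta:\mathcal{A}\to\mathcal{B}$ be a surjective bounded linear map from a C*-algebra $\mathcal{A}$ onto a C*-algebra $\mathcal{B}$. Suppose that $\theta(a)\theta(b)=0$ for all $a,b\in\mathcal{A}$ with $ab=0$. Then $\theta(1):=\theta^{**}(1)$ is a central element of, and invertible in, $M(\mathcal{B})$. Moreover, $\theta=\theta(1)\varphi$ for a surjective algebra homomorphism $\varphi$ from $\mathcal{A}$ onto $\mathcal{B}$, i.e. $\theta(a)=\theta(1)\varphi(a)$ for all $a\in\mathcal{A}$.
   Context: C*-algebras are complex and are not assumed to have an identity. The bidual $\mathcal{A}^{**}$ is regarded as the enveloping W*-algebra of $\mathcal{A}$, with identity $1$ (similarly for $\mathcal{B}^{**}$), and $\theta^{**}:\mathcal{A}^{**}\to\mathcal{B}^{**}$ is the bidual map of $\theta$. The notation $\theta(1)$ means $\theta^{**}(1)\in\mathcal{B}^{**}$. The multiplier algebra of $\mathcal{B}$ is the C*-subalgebra $M(\mathcal{B})=\{x\in\mathcal{B}^{**}: x\mathcal{B}\subseteq\mathcal{B}\text{ and }\mathcal{B}x\subseteq\mathcal{B}\}$ of $\mathcal{B}^{**}$. An algebra homomorphism is a linear multiplicative map, not required to preserve the involution. *)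

(* Defs.v *)
From HB Require Import structures.
From mathcomp Require Import all_boot all_order all_algebra.
From mathcomp Require Import all_classical all_reals all_analysis.
From mathcomp Require Import complex.
Set Implicit Arguments.
Unset Strict Implicit.
Unset Printing Implicit Defensive.
Import Order.TTheory GRing.Theory Num.Theory.
Import numFieldNormedType.Exports.
Local Open Scope classical_set_scope.
Local Open Scope complex_scope.
Local Open Scope ring_scope.

Declare Scope cstar_scope.
Delimit Scope cstar_scope with cstar.

Reserved Notation "a ** b" (at level 40, left associativity).

(* MathComp rings are unital, so the product is a separate operation.  The
   norm takes values in R[i], as for any normedModType over R[i]. *)
HB.mixin Record isCStarAlgebra (R : realType) A
    & CompleteNormedModule (complex R) A := {
  cmul : A -> A -> A;
  cstar : A -> A;
  cmulA : associative cmul;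
  cmulDl : left_distributive cmul +%R;
  cmulDr : right_distributive cmul +%R;
  cmulZl : forall (k : R[i]) a b, cmul (k *: a) b = k *: cmul a b;
  cmulZr : forall (k : R[i]) a b, cmul a (k *: b) = k *: cmul a b;
  cstarD : {morph cstar : a b / a + b >-> a + b};
  cstarZ : forall (k : R[i]) a, cstar (k *: a) = k^* *: cstar a;
  cstarM : forall a b, cstar (cmul a b) = cmul (cstar b) (cstar a);
  cstarK : involutive cstar;
  cnormM : forall a b, `|cmul a b| <= `|a| * `|b|;
  cnorm_star_mul : forall a, `|cmul (cstar a) a| = `|a| ^+ 2
}.

#[short(type="cstarAlgType")]
HB.structure Definition CStarAlgebra (R : realType) :=
  {A of CompleteNormedModule (complex R) A & isCStarAlgebra R A}.

Notation "a ** b" := (cmul a b) : cstar_scope.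
Local Open Scope cstar_scope.

Lemma real_complexM (R : realType) (x y : R) : (x * y)%:C = x%:C * y%:C.
Proof. exact: rmorphM. Qed.

Lemma real_complexD (R : realType) (x y : R) : (x + y)%:C = x%:C + y%:C.
Proof. exact: rmorphD. Qed.

Section BoundedLinear.
Variables (R : realType) (E F : normedModType R[i]).

Definition bounded_op (f : E -> F) : Prop :=
  exists M : R, forall x, `|f x| <= M%:C * `|x|.

Lemma bounded_opI f (c : R[i]) :
  (forall x, `|f x| <= c * `|x|) -> bounded_op f.
Proof.
move=> fc; exists (complex.Re `|c|) => x.
rewrite RRe_real ?ger0_real //; have [/normr0_eq0 x0|x0] := eqVneq `|x| 0.
  by have := fc x; rewrite x0 normr0 !mulr0.
have x_gt0 : 0 < `|x| by rewrite lt0r x0 normr_ge0.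
apply: le_trans (fc x) _; rewrite ler_wpM2r //.
have c0 : 0 <= c.
  by have := le_trans (normr_ge0 _) (fc x); rewrite pmulr_lge0.
by rewrite ger0_norm.
Qed.

Record blin := BLin {
  blin_fun :> E -> F;
  blin_linear : linear blin_fun;
  blin_bounded : bounded_op blin_fun
}.

HB.instance Definition _ (f : blin) :=
  GRing.isLinear.Build R[i] E F *:%R (blin_fun f) (@blin_linear f).

Lemma blinP (f g : blin) : (forall x, f x = g x) -> f = g.
Proof.
case: f g => [f fl fb] [g gl gb] /= /funext fg; subst g.
by rewrite (Prop_irrelevance fl gl) (Prop_irrelevance fb gb).
Qed.

End BoundedLinear.

Notation "{ 'blin' E -> F }" := (blin E F)
  (at level 0, E at level 98, F at level 99, format "{ 'blin'  E  ->  F }").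

Section BoundedLinearSpace.
Variables (R : realType) (E F : normedModType R[i]).
Implicit Types f g : {blin E -> F}.

HB.instance Definition _ := gen_eqMixin {blin E -> F}.
HB.instance Definition _ := gen_choiceMixin {blin E -> F}.

Let Nre (V : normedModType R[i]) (x : V) : R := complex.Re `|x|.

Let NreE (V : normedModType R[i]) (x : V) : `|x| = (Nre x)%:C.
Proof. by rewrite /Nre RRe_real // ger0_real. Qed.

Let Nre_ge0 (V : normedModType R[i]) (x : V) : 0 <= Nre x.
Proof. by rewrite -ler0c -NreE. Qed.

Definition opbounds f : set R :=
  [set M | 0 <= M /\ forall x, `|f x| <= M%:C * `|x|].

Lemma opboundsE f M :
  opbounds f M <-> 0 <= M /\ forall x, Nre (f x) <= M * Nre x.
Proof.
by split=> -[M0 fM]; split=> // x; have := fM x; rewrite !NreE -real_complexM lecR.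
Qed.

Lemma bounded_opP f : opbounds f !=set0.
Proof.
have [M fM] := blin_bounded f; exists (Num.max 0 M).
rewrite opboundsE; split; first by rewrite le_max lexx.
move=> x; have := fM x; rewrite !NreE -real_complexM lecR => /le_trans; apply.
by rewrite ler_wpM2r // le_max lexx orbT.
Qed.

Definition opnorm f : R := inf (opbounds f).

Lemma opbounds_inf f : has_inf (opbounds f).
Proof. by split; [exact: bounded_opP | exists 0 => M []]. Qed.

Lemma opnorm_ge0 f : 0 <= opnorm f.
Proof. by apply: lb_le_inf; [exact: bounded_opP | move=> M []]. Qed.

Lemma opnorm_le f M : opbounds f M -> opnorm f <= M.
Proof. by move=> fM; apply: inf_lbound => //; exists 0 => ? []. Qed.

Lemma opnorm_bound f : opbounds f (opnorm f).
Proof.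
rewrite opboundsE; split=> [|x]; first exact: opnorm_ge0.
have [/eqP x0|x0] := eqVneq (Nre x) 0.
  have [M] := bounded_opP f; rewrite opboundsE => -[_ /(_ x)].
  by rewrite (eqP x0) !mulr0.
have x_gt0 : 0 < Nre x by rewrite lt0r x0 Nre_ge0.
rewrite -ler_pdivrMr //; apply: lb_le_inf; first exact: bounded_opP.
by move=> M; rewrite opboundsE => -[_ fM]; rewrite ler_pdivrMr.
Qed.

Lemma blin0_linear : linear (fun _ : E => 0 : F).
Proof. by move=> k x y; rewrite scaler0 addr0. Qed.
Lemma blin0_bounded : bounded_op (fun _ : E => 0 : F).
Proof. by exists 0 => x; rewrite normr0 mul0r. Qed.
Definition blin0 := BLin blin0_linear blin0_bounded.

Lemma blinD_linear f g : linear (fun x => f x + g x).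
Proof. by move=> k x y; rewrite !linearP scalerDr addrACA. Qed.
Lemma blinD_opbounds f g x :
  `|f x + g x| <= (opnorm f + opnorm g)%:C * `|x|.
Proof.
rewrite real_complexD mulrDl (le_trans (ler_normD _ _)) // lerD //.
  by case: (opnorm_bound f).
by case: (opnorm_bound g).
Qed.
Lemma blinD_bounded f g : bounded_op (fun x => f x + g x).
Proof. by exists (opnorm f + opnorm g); exact: blinD_opbounds. Qed.
Definition blinD f g := BLin (blinD_linear f g) (blinD_bounded f g).

Lemma blinZ_linear (k : R[i]) f : linear (fun x => k *: f x).
Proof.
by move=> l x y; rewrite linearP scalerDr !scalerA [k * l]mulrC.
Qed.
Lemma blinZ_opbounds (k : R[i]) f x :
  `|k *: f x| <= (complex.Re `|k| * opnorm f)%:C * `|x|.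
Proof.
rewrite normrZ real_complexM RRe_real ?ger0_real // -mulrA ler_wpM2l //.
by case: (opnorm_bound f).
Qed.
Lemma blinZ_bounded (k : R[i]) f : bounded_op (fun x => k *: f x).
Proof. by exists (complex.Re `|k| * opnorm f); exact: blinZ_opbounds. Qed.
Definition blinZ k f := BLin (blinZ_linear k f) (blinZ_bounded k f).

Lemma blinDA : associative blinD.
Proof. by move=> f g h; apply: blinP => x /=; rewrite addrA. Qed.
Lemma blinDC : commutative blinD.
Proof. by move=> f g; apply: blinP => x /=; rewrite addrC. Qed.
Lemma blin0D : left_id blin0 blinD.
Proof. by move=> f; apply: blinP => x /=; rewrite add0r. Qed.
Lemma blinND : left_inverse blin0 (blinZ (-1)) blinD.
Proof. by move=> f; apply: blinP => x /=; rewrite scaleN1r addNr. Qed.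

HB.instance Definition _ :=
  GRing.isZmodule.Build {blin E -> F} blinDA blinDC blin0D blinND.

Lemma blinZA k l f : blinZ k (blinZ l f) = blinZ (k * l) f.
Proof. by apply: blinP => x /=; rewrite scalerA. Qed.
Lemma blinZ1 : left_id 1 blinZ.
Proof. by move=> f; apply: blinP => x /=; rewrite scale1r. Qed.
Lemma blinZDr : right_distributive blinZ +%R.
Proof. by move=> k f g; apply: blinP => x /=; rewrite scalerDr. Qed.
Lemma blinZDl f : {morph blinZ^~ f : k l / k + l}.
Proof. by move=> k l; apply: blinP => x /=; rewrite scalerDl. Qed.

HB.instance Definition _ := GRing.Zmodule_isLmodule.Build
  R[i] {blin E -> F} blinZA blinZ1 blinZDr blinZDl.

Lemma opnormD f g : (opnorm (f + g))%:C <= (opnorm f)%:C + (opnorm g)%:C.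
Proof.
rewrite -real_complexD lecR; apply: opnorm_le; split.
  by rewrite addr_ge0 // opnorm_ge0.
exact: blinD_opbounds.
Qed.

Lemma opnorm0_eq0 f : (opnorm f)%:C = 0 -> f = 0.
Proof.
move=> [f0]; apply: blinP => x; apply/normr0_eq0/eqP.
rewrite eq_le normr_ge0 andbT; have [_ /(_ x)] := opnorm_bound f.
by rewrite f0 mul0r.
Qed.

Let opnormZ_le (k : R[i]) f :
  opnorm (k *: f) <= complex.Re `|k| * opnorm f.
Proof.
apply: opnorm_le; split; last exact: blinZ_opbounds.
by rewrite mulr_ge0 ?opnorm_ge0 // -ler0c RRe_real ?ger0_real.
Qed.

Lemma opnormZ (k : R[i]) f : (opnorm (k *: f))%:C = `|k| * (opnorm f)%:C.
Proof.
have kE (l : R[i]) : (complex.Re `|l|)%:C = `|l|.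
  by rewrite RRe_real ?ger0_real.
apply: le_anti; apply/andP; split.
  by rewrite -kE -real_complexM lecR opnormZ_le.
have [->|k0] := eqVneq k 0.
  by rewrite normr0 mul0r ler0c opnorm_ge0.
have := opnormZ_le k^-1 (k *: f).
rewrite scalerA mulVf // scale1r -lecR real_complexM kE normfV.
by rewrite mulrC ler_pdivlMr ?normr_gt0 // mulrC.
Qed.

HB.instance Definition _ := Lmodule_isNormed.Build R[i] {blin E -> F}
  opnormD opnormZ opnorm0_eq0.

Lemma blin_normE f : `|f| = (opnorm f)%:C.
Proof. by []. Qed.

Lemma blin_norm_leP f (c : R[i]) :
  0 <= c -> (forall x, `|f x| <= c * `|x|) -> `|f| <= c.
Proof.
move=> c0 fc; rewrite blin_normE -(RRe_real (ger0_real c0)) lecR.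
apply: opnorm_le; split; first by rewrite -ler0c RRe_real // ger0_real.
by move=> x; rewrite RRe_real // ger0_real.
Qed.

Lemma blin_norm_le f x : `|f x| <= `|f| * `|x|.
Proof. by case: (opnorm_bound f). Qed.

End BoundedLinearSpace.

Notation dual E := {blin E -> (_[i])^o}.
Notation bidual E := (dual (dual E)).

Section Bidual.
Variable R : realType.
Implicit Types E F : normedModType R[i].

Lemma transpose_fun_linear E F (T : {blin E -> F}) (g : dual F) :
  linear ((fun x => g (T x)) : E -> (R[i])^o).
Proof. by move=> k x y; rewrite !linearP. Qed.
Lemma transpose_fun_le E F (T : {blin E -> F}) (g : dual F) x :
  `|g (T x)| <= `|g| * `|T| * `|x|.
Proof.
rewrite (le_trans (blin_norm_le _ _)) // -mulrA ler_wpM2l //.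
exact: blin_norm_le.
Qed.
Lemma transpose_fun_bounded E F (T : {blin E -> F}) (g : dual F) :
  bounded_op ((fun x => g (T x)) : E -> (R[i])^o).
Proof. by apply: bounded_opI => x; exact: transpose_fun_le. Qed.
Definition transpose_dual E F (T : {blin E -> F}) (g : dual F) : dual E :=
  BLin (transpose_fun_linear T g) (transpose_fun_bounded T g).

Lemma transpose_linear E F (T : {blin E -> F}) : linear (transpose_dual T).
Proof. by move=> k g h; apply: blinP. Qed.
Lemma transpose_le E F (T : {blin E -> F}) g :
  `|transpose_dual T g| <= `|T| * `|g|.
Proof.
by apply: blin_norm_leP => // x; rewrite [`|T| * _]mulrC transpose_fun_le.
Qed.
Lemma transpose_bounded E F (T : {blin E -> F}) :
  bounded_op (transpose_dual T).
Proof. by apply: bounded_opI; exact: transpose_le. Qed.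
Definition transpose E F (T : {blin E -> F}) : {blin dual F -> dual E} :=
  BLin (transpose_linear T) (transpose_bounded T).

Definition bitranspose E F (T : {blin E -> F}) : {blin bidual E -> bidual F} :=
  transpose (transpose T).

Lemma evaluation_linear E (x : E) :
  linear ((fun f => f x) : dual E -> (R[i])^o).
Proof. by []. Qed.
Lemma evaluation_bounded E (x : E) :
  bounded_op ((fun f => f x) : dual E -> (R[i])^o).
Proof.
by apply: (bounded_opI (c := `|x|)) => f; rewrite mulrC blin_norm_le.
Qed.
Definition to_bidual E (x : E) : bidual E :=
  BLin (evaluation_linear x) (evaluation_bounded x).

End Bidual.

(* The enveloping W*-algebra is realised as the bidual with the (first) Arens
   product: <f.a, b> = <f, ab>, <F.f, a> = <F, f.a>, <F G, f> = <F, G.f>.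
   C*-algebras are Arens regular, so this is the product of the bicommutant of
   the universal representation under its canonical identification with the
   bidual. *)
Section Arens.
Variables (R : realType) (A : cstarAlgType R).
Implicit Types (a b : A) (f : dual A) (F G : bidual A).

Lemma dual_act_linear f a : linear ((fun b => f (a ** b)) : A -> (R[i])^o).
Proof. by move=> k b c; rewrite cmulDr cmulZr linearP. Qed.
Lemma dual_act_le f a b : `|f (a ** b)| <= `|f| * `|a| * `|b|.
Proof.
by rewrite (le_trans (blin_norm_le _ _)) // -mulrA ler_wpM2l // cnormM.
Qed.
Lemma dual_act_bounded f a :
  bounded_op ((fun b => f (a ** b)) : A -> (R[i])^o).
Proof. by apply: bounded_opI => b; exact: dual_act_le. Qed.
Definition dual_act f a : dual A :=
  BLin (dual_act_linear f a) (dual_act_bounded f a).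

Lemma dual_act_norm f a : `|dual_act f a| <= `|f| * `|a|.
Proof. by apply: blin_norm_leP => [|b]; [rewrite mulr_ge0 | exact: dual_act_le]. Qed.

Lemma bidual_act_linear F f :
  linear ((fun a => F (dual_act f a)) : A -> (R[i])^o).
Proof.
move=> k a b; rewrite -linearP; congr (F _); apply: blinP => c /=.
by rewrite cmulDl cmulZl linearP.
Qed.
Lemma bidual_act_le F f a : `|F (dual_act f a)| <= `|F| * `|f| * `|a|.
Proof.
by rewrite (le_trans (blin_norm_le _ _)) // -mulrA ler_wpM2l // dual_act_norm.
Qed.
Lemma bidual_act_bounded F f :
  bounded_op ((fun a => F (dual_act f a)) : A -> (R[i])^o).
Proof. by apply: bounded_opI => a; exact: bidual_act_le. Qed.
Definition bidual_act F f : dual A :=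
  BLin (bidual_act_linear F f) (bidual_act_bounded F f).

Lemma bidual_act_norm F f : `|bidual_act F f| <= `|F| * `|f|.
Proof. by apply: blin_norm_leP => [|a]; [rewrite mulr_ge0 | exact: bidual_act_le]. Qed.

Lemma arens_linear F G :
  linear ((fun f => F (bidual_act G f)) : dual A -> (R[i])^o).
Proof.
move=> k f g; rewrite -linearP; congr (F _); apply: blinP => a /=.
by rewrite -linearP; congr (G _); apply: blinP.
Qed.
Lemma arens_bounded F G :
  bounded_op ((fun f => F (bidual_act G f)) : dual A -> (R[i])^o).
Proof.
apply: (bounded_opI (c := `|F| * `|G|)) => f.
by rewrite (le_trans (blin_norm_le _ _)) // -mulrA ler_wpM2l // bidual_act_norm.
Qed.
Definition arens F G : bidual A := BLin (arens_linear F G) (arens_bounded F G).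

Lemma arens_to_bidual a b :
  arens (to_bidual a) (to_bidual b) = to_bidual (a ** b).
Proof. exact: blinP. Qed.

Definition is_bidual_one (e : bidual A) : Prop :=
  forall F, arens e F = F /\ arens F e = F.

Lemma is_bidual_one_uniq e e' : is_bidual_one e -> is_bidual_one e' -> e = e'.
Proof. by move=> he he'; rewrite -(he e').1 (he' e).2. Qed.

(* The default value 0 is never used: every C*-algebra has a two-sided
   identity in its bidual. *)
Definition bidual_one : bidual A := xget 0 is_bidual_one.

Definition multiplier_algebra : set (bidual A) :=
  [set x | forall b : A,
    range (@to_bidual R A) (arens x (to_bidual b)) /\
    range (@to_bidual R A) (arens (to_bidual b) x)].

End Arens.

Arguments bidual_one {R} A.
Arguments multiplier_algebra {R} A.

(* Main.v *)
(* [B(x, y) = theta x ** theta y] vanishes on zero products, which forces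
   theta(ab) theta(c) = theta(a) theta(bc): for [b] self-adjoint, cut [b] by the
   continuous functional calculus into [n] orthogonal pieces, up to neighbours.
   Therefore theta(ab) |-> theta(a) theta(b) is well defined.  It is multiplication
   by theta(1), and it is a bijective central multiplier [T] of [B], whose inverse
   [S] is bounded by uniform boundedness; then [phi = S \o theta] is multiplicative.
   The functional calculus is obtained without spectral theory: a small
   self-adjoint [h] is the real part of a unitary [u], so [p(h)] for a polynomial
   [p] is a Laurent polynomial in [u], whose coefficients are bounded by the
   supremum of |p| on [-1, 1]; applying this to the powers p^(2^k) removes the
   loss due to the number of coefficients.
   The identity of the bidual is the weak-* limit of an approximate unit; the
   convergence f((1 - u) y) -> 0, uniformly in the unit ball, for a functional [f]
   comes from orthogonality: if [f] almost attains its norm at [x = v x] and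
   [v d = 0], then |x + t d y|^2 <= 1 + t^2 forces f(d y) to be small. *)
Require Import Defs.
From HB Require Import structures.
From mathcomp Require Import all_boot all_order all_algebra.
From mathcomp Require Import all_classical all_reals all_analysis.
From mathcomp Require Import complex cyclic separable cyclotomic.
From mathcomp Require Import ring lra zify.
Set Implicit Arguments.
Unset Strict Implicit.
Unset Printing Implicit Defensive.
Import Order.TTheory GRing.Theory Num.Theory.
Import numFieldNormedType.Exports.
Local Open Scope classical_set_scope.
Local Open Scope complex_scope.
Local Open Scope ring_scope.
Local Open Scope cstar_scope.

(** * Polynomial approximation and coefficient bounds *)

Section PolynomialApproximation.
Variable R : realType.
Implicit Types (f g : R -> R) (p : {poly R}).

(** [A] need not have an identity, so theta(1) exists only in the bidual and the balance identity
    cannot be evaluated at 1. The work is therefore done with maps of [B]. Products span [A], so the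
    elements theta(ab) span [B] and a linear map on [B] is fixed by its values there; only at the
    end are T and S matched with the bidual elements theta**(1) and S**(1). Forming the second one
    is what requires S to be bounded. Multiplicativity of [phi] comes from T being central: T sends
    theta(a) S(theta(a')) to theta(a) theta(a'), which is also T(theta(aa')). The functional
    calculus works with norms alone; no order on self-adjoint elements is introduced. The
    normalization |h| <= 1/2 makes the iteration for sqrt(1 - h^2) contract, and it costs nothing
    because the statements to be proved are stable under linear combinations. The approximate unit
    is not organized as a net either: it is reached through finite lists of requirements that one
    contraction can meet. *)

Definition poly_approx f : Prop := forall e, 0 < e ->
  exists p, forall x, `|x| <= 1 -> `|f x - p.[x]| <= e.

(* The Bernstein polynomial, as the expectation of [F] at the end of an
   [n]-step walk whose steps are 1 with probability [x] and 0 otherwise. *)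
Fixpoint bernstein (n : nat) (F : nat -> R) : {poly R} :=
  if n is m.+1 then 'X * bernstein m (fun k => F k.+1) + (1 - 'X) * bernstein m F
  else (F 0)%:P.

Lemma bernsteinB n F G x :
  (bernstein n (fun k => F k - G k)).[x] =
  (bernstein n F).[x] - (bernstein n G).[x].
Proof.
elim: n F G => [|n IH] F G /=; first by rewrite !hornerE.
by rewrite !hornerE !IH; ring.
Qed.

Lemma bernstein_cst n c x : (bernstein n (fun=> c)).[x] = c.
Proof. by elim: n => [|n IH] /=; rewrite !hornerE ?IH; ring. Qed.

Lemma bernstein_le n F G x : 0 <= x <= 1 -> (forall k, (k <= n)%N -> F k <= G k) ->
  (bernstein n F).[x] <= (bernstein n G).[x].
Proof.
move=> /andP[x0 x1]; elim: n F G => [|n IH] F G FG /=; rewrite !hornerE.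
  exact: FG.
rewrite lerD // ler_wpM2l ?subr_ge0 //; apply: IH => k kn; apply: FG => //.
exact: leqW.
Qed.

Lemma bernstein_affine n a b F x :
  (bernstein n (fun k => a + b * F k)).[x] = a + b * (bernstein n F).[x].
Proof.
elim: n F => [|n IH] F /=; first by rewrite !hornerE.
by rewrite !hornerE !IH; ring.
Qed.

(** Squared mean plus variance of the binomial law, displaced by c. The free c lets the induction
    absorb a first step equal to 1; the application has c = - n x, where only the variance
    remains. *)
Lemma bernstein_moment n c x :
  (bernstein n (fun k => (c + k%:R) ^+ 2)).[x] =
  (c + n%:R * x) ^+ 2 + n%:R * x * (1 - x).
Proof.
elim: n c => [|n IH] c /=; first by rewrite !hornerE /=; ring.
rewrite !hornerE IH.
have -> : (fun k => (c + k.+1%:R) ^+ 2) = (fun k => (c + 1 + k%:R) ^+ 2).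
  by apply/funext => k; rewrite -natr1; ring.
by rewrite IH -natr1; ring.
Qed.

Lemma bernstein_approx f (M : R) :
  (forall e, 0 < e -> exists2 d, 0 < d &
    forall x y, 0 <= x <= 1 -> 0 <= y <= 1 -> `|x - y| < d -> `|f x - f y| <= e) ->
  (forall x, 0 <= x <= 1 -> `|f x| <= M) ->
  forall e, 0 < e -> exists p, forall x, 0 <= x <= 1 -> `|f x - p.[x]| <= e.
Proof.
move=> fc fM e e0.
have M0 : 0 <= M by apply: le_trans (fM 0 _); rewrite ?lexx ?ler01.
have [d d0 fd] : exists2 d, 0 < d & forall x y, 0 <= x <= 1 -> 0 <= y <= 1 ->
  `|x - y| < d -> `|f x - f y| <= e / 2 by apply: fc; rewrite divr_gt0.
pose K := 2 * M / d ^+ 2.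
have K0 : 0 <= K by rewrite divr_ge0 ?sqr_ge0 // mulr_ge0.
pose n := (Num.truncn (2 * K / e)).+1.
have n0 : 0 < n%:R :> R by rewrite ltr0n.
have nK : K / n%:R <= e / 2.
  rewrite ler_pdivrMr //.
  have : 2 * K / e <= n%:R by rewrite ltW // truncnS_gt.
  by rewrite ler_pdivrMr // => h; lra.
exists (bernstein n (fun k => f (k%:R / n%:R))) => x x01.
have kn01 k : (k <= n)%N -> 0 <= (k%:R / n%:R : R) <= 1.
  by move=> kn; rewrite divr_ge0 //= ler_pdivrMr // mul1r ler_nat.
(* Chebyshev's majorant of |f(x) - f(k/n)|: e/2 covers the k/n within d of x, and the square covers
   the others, where 2M <= K (x - k/n)^2. Its expectation is e/2 + K x (1 - x) / n. *)
pose G k : R := e / 2 + (K / n%:R ^+ 2) * (- (n%:R * x) + k%:R) ^+ 2.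
have GE : (bernstein n G).[x] <= e.
  rewrite bernstein_affine bernstein_moment addNr expr0n /= add0r.
  rewrite (_ : _ * _ = K / n%:R * (x * (1 - x))); last by field; rewrite lt0r_neq0.
  have : x * (1 - x) <= 1 by nra.
  move: (K / _) nK (divr_ge0 K0 (ltW n0)) => q nK q0 xx.
  by nra.
have FG k : (k <= n)%N -> `|f x - f (k%:R / n%:R)| <= G k.
  move=> kn; have k01 := kn01 k kn.
  have Ksq : 0 <= K / n%:R ^+ 2 * (- (n%:R * x) + k%:R) ^+ 2.
    by rewrite mulr_ge0 ?sqr_ge0 // divr_ge0 ?sqr_ge0.
  have [xd|dx] := ltP `|x - k%:R / n%:R| d.
    by apply: le_trans (fd _ _ x01 k01 xd) _; rewrite lerDl.
  apply: (le_trans (ler_normB _ _)).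
  apply: (@le_trans _ _ (2 * M)); first by rewrite mulr2n mulrDl mul1r lerD // fM.
  apply: (@le_trans _ _ (K * (x - k%:R / n%:R) ^+ 2)).
    rewrite /K mulrAC ler_pdivlMr ?exprn_gt0 // ler_wpM2l ?mulr_ge0 //.
    by rewrite -[leRHS]real_normK ?num_real // ler_sqr ?nnegrE // ltW.
  rewrite (_ : _ * _ = K / n%:R ^+ 2 * (- (n%:R * x) + k%:R) ^+ 2); last first.
    by field; rewrite lt0r_neq0.
  by rewrite lerDr; lra.
rewrite ler_norml; apply/andP; split.
- rewrite -(bernstein_cst n (f x) x) -bernsteinB.
  apply: (@le_trans _ _ (bernstein n (fun k => - (G k))).[x]).
    have -> : (fun k => - G k) = (fun k => 0 + -1 * G k).
      by apply/funext => k; ring.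
    by rewrite bernstein_affine; lra.
  by apply: bernstein_le => // k kn; have := FG k kn; rewrite ler_norml => /andP[].
- rewrite -(bernstein_cst n (f x) x) -bernsteinB.
  apply: (le_trans _ GE); apply: bernstein_le => // k kn.
  by have := FG k kn; rewrite ler_norml => /andP[].
Qed.

Lemma weierstrass_approx f (M : R) :
  (forall e, 0 < e -> exists2 d, 0 < d &
    forall x y, `|x| <= 1 -> `|y| <= 1 -> `|x - y| < d -> `|f x - f y| <= e) ->
  (forall x, `|x| <= 1 -> `|f x| <= M) -> poly_approx f.
Proof.
move=> fc fM e e0.
have I01 (x : R) : 0 <= x <= 1 -> `|2 * x - 1| <= 1.
  by move=> x01; rewrite ler_norml; lra.
have [] := @bernstein_approx (fun x => f (2 * x - 1)) M _ _ e e0.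
- move=> e1 e1_0; have [d d0 fd] := fc e1 e1_0.
  exists (d / 2) => [|x y /I01 x1 /I01 y1 xy]; first by rewrite divr_gt0.
  apply: fd => //; rewrite (_ : _ - _ = 2 * (x - y)); last by ring.
  by rewrite normrM ger0_norm //; lra.
- by move=> x /I01; exact: fM.
move=> p hp; exists (p \Po (2^-1%:P * ('X + 1))) => x x1.
rewrite horner_comp !hornerE.
have -> : f x = f (2 * (2^-1 * (x + 1)) - 1) by congr f; field.
by apply: hp; move: x1; rewrite ler_norml; lra.
Qed.

Lemma lipschitz_poly_approx f (K : R) :
  (forall x y, `|f x - f y| <= K * `|x - y|) -> poly_approx f.
Proof.
move=> fK.
have K0 : 0 <= K.
  by have := le_trans (normr_ge0 _) (fK 1 0); rewrite subr0 normr1 mulr1.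
apply: (@weierstrass_approx _ (`|f 0| + K)).
  move=> e e0; exists (e / (K + 1)); first by rewrite divr_gt0 // ltr_wpDl.
  move=> x y _ _; rewrite ltr_pdivlMr ?ltr_wpDl // => xy.
  apply: (le_trans (fK _ _)); have := normr_ge0 (x - y); move: xy; nra.
move=> x x1; rewrite -[f x](subrK (f 0)) addrC (le_trans (ler_normD _ _)) //.
rewrite lerD // (le_trans (fK _ _)) // subr0 -[leRHS]mulr1.
by rewrite ler_wpM2l.
Qed.

(** [Num.sqrt] is 0 on negative reals, so this is the square root of the positive part. It is not
    Lipschitz at 0; the inequality (sqrt x - sqrt y)^2 <= |x - y| gives the modulus of continuity
    e^2 instead. *)
Lemma sqrt_poly_approx : poly_approx (fun x => Num.sqrt x).
Proof.
have sqle (x y : R) : y <= x -> (Num.sqrt x - Num.sqrt y) ^+ 2 <= x - y.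
  move=> xy; have [x0|x0] := ltP x 0.
    by rewrite !ltr0_sqrtr //; [nra | exact: le_lt_trans x0].
  have [y0|y0] := ltP y 0.
    by rewrite (ltr0_sqrtr y0) subr0 sqr_sqrtr //; lra.
  have := sqr_sqrtr x0; have := sqr_sqrtr y0; have := sqrtr_ge0 y.
  have := ler_wsqrtr xy; nra.
have sqN (x y : R) : (Num.sqrt x - Num.sqrt y) ^+ 2 <= `|x - y|.
  have [yx|xy] := leP y x; first by rewrite ger0_norm ?subr_ge0 // sqle.
  by rewrite ltr0_norm ?subr_lt0 // opprB -sqrrN opprB sqle // ltW.
apply: (@weierstrass_approx _ 1).
  move=> e e0; exists (e ^+ 2); first exact: exprn_gt0.
  move=> x y _ _ /ltW xy; rewrite -ler_sqr ?nnegrE ?normr_ge0 ?(ltW e0) //.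
  by rewrite real_normK ?num_real // (le_trans (sqN _ _)).
move=> x; rewrite ler_norml => /andP[_ x1].
by rewrite ger0_norm ?sqrtr_ge0 // -sqrtr1 ler_wsqrtr.
Qed.

Lemma poly_approx_opp f : poly_approx f -> poly_approx (fun x => f (- x)).
Proof.
move=> fa e e0; have [p hp] := fa e e0; exists (p \Po (- 'X)) => x x1.
by rewrite horner_comp !hornerE; apply: hp; rewrite normrN.
Qed.

End PolynomialApproximation.

(** * A piecewise linear partition of unity *)

Section Hats.
Variable R : realType.

Definition hat (i : nat) (y : R) : R := Num.max 0 (1 - `|y - i%:R|).

Lemma hat_ge0 i y : 0 <= hat i y.
Proof. by rewrite /hat le_max lexx. Qed.

Lemma max0_lipschitz (x y : R) : `|Num.max 0 x - Num.max 0 y| <= `|x - y|.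
Proof.
by rewrite !maxEle; case: ifP => h1; case: ifP => h2;
  rewrite ?subrr ?normr0 ?normr_ge0 // ?sub0r ?subr0 ?normrN;
  rewrite ler_norml; case: (lerP 0 (x - y)) => h3;
  rewrite ?(ger0_norm h3) ?(ltr0_norm h3);
  case: (lerP 0 x) => h4; case: (lerP 0 y) => h5;
  rewrite ?(ger0_norm h4) ?(ltr0_norm h4) ?(ger0_norm h5) ?(ltr0_norm h5); lra.
Qed.

Lemma hat_lipschitz i (x y : R) : `|hat i x - hat i y| <= `|x - y|.
Proof.
apply: (le_trans (max0_lipschitz _ _)).
have -> : 1 - `|x - i%:R| - (1 - `|y - i%:R|) = `|y - i%:R| - `|x - i%:R| by ring.
apply: (le_trans (ler_dist_dist _ _)).
by rewrite opprB addrA subrK distrC.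
Qed.

Lemma hat_eq0 i (y : R) : 1 <= `|y - i%:R| -> hat i y = 0.
Proof. by move=> h; rewrite /hat max_l // subr_le0. Qed.

Lemma hatM0 i j (y : R) : (i.+2 <= j)%N -> hat i y * hat j y = 0.
Proof.
move=> ij; have [h|h] := lerP 1 `|y - i%:R|; first by rewrite hat_eq0 ?mul0r.
rewrite (hat_eq0 (i := j)) ?mulr0 //.
have : i%:R + 2 <= j%:R :> R by rewrite -natrD ler_nat addn2.
move: h; rewrite ltr_norml => /andP[h1 h2] h3.
by rewrite distrC ger0_norm; lra.
Qed.

(** Piecewise linear interpolation at the integers reproduces 1 and the identity: on [n, n + 1] only
    the last two hats are nonzero. *)
Lemma sum_hat n (y : R) : 0 <= y <= n%:R ->
  \sum_(i < n.+1) hat i y = 1 /\ \sum_(i < n.+1) i%:R * hat i y = y.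
Proof.
elim: n => [|n IH] /andP[y0 yn].
  have -> : y = 0 by apply: le_anti; rewrite y0 yn.
  by rewrite !big_ord_recr !big_ord0 /= /hat subrr normr0 subr0 max_r //; split; ring.
rewrite big_ord_recr [in X in _ /\ X]big_ord_recr /=.
have [yn'|yn'] := leP y n%:R.
  have [-> ->] := IH (introT andP (conj y0 yn')).
  rewrite hat_eq0; first by split; ring.
  by rewrite -natr1 distrC ger0_norm; lra.
have yn1 : y <= n%:R + 1 by rewrite natr1.
have h0 (i : 'I_n) : hat i y = 0.
  have : i%:R + 1 <= n%:R :> R by rewrite natr1 ler_nat.
  by move=> h; apply: hat_eq0; rewrite ger0_norm; lra.
rewrite !big_ord_recr /=.
rewrite [X in X + _ + _]big1 ?[X in _ /\ X + _ + _ = _]big1; last 2 first.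
- by move=> i _; rewrite h0 mulr0.
- by move=> i _; rewrite h0.
have -> : hat n y = n%:R + 1 - y.
  by rewrite /hat ger0_norm ?subr_ge0 ?ltW // max_r; lra.
have -> : hat n.+1 y = y - n%:R.
  have E : y - n.+1%:R = y - n%:R - 1 by rewrite -natr1 opprD addrA.
  have E0 : y - n%:R - 1 <= 0 by lra.
  by rewrite /hat E (ler0_norm E0) max_r opprK addrC subrK // subr_ge0 ltW.
by rewrite -natr1; split; ring.
Qed.

End Hats.

(** Exponential growth beats linear growth. Bernoulli's inequality is itself only linear, so it is
    applied at 2^k and squared, which contradicts the hypothesis at k + 1. *)
Lemma exp_growth_le1 (R : realType) (x C : R) : 0 <= x ->
  (forall k, x ^+ (2 ^ k)%N <= C * (2 ^ k)%:R) -> x <= 1.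
Proof.
move=> x0 xC; rewrite leNgt; apply/negP => x1.
have t0 : 0 < x - 1 by rewrite subr_gt0.
have lb n : n%:R * (x - 1) <= x ^+ n.
  elim: n => [|n IH]; first by rewrite mul0r expr0.
  rewrite exprS -natr1; have u1 : 0 <= x ^+ n - 1 by rewrite subr_ge0 exprn_ege1 // ltW.
  have := mulr_ge0 (ltW t0) u1; move: (x ^+ n) IH => u; nra.
pose k := (Num.truncn (2 * C / (x - 1) ^+ 2)).+1.
have kC : 2 * C / (x - 1) ^+ 2 < (2 ^ k)%:R.
  by apply: lt_trans (truncnS_gt _) _; rewrite ltr_nat ltn_expl.
rewrite ltr_pdivrMr ?exprn_gt0 // in kC.
have := xC k.+1; rewrite expnS mulnC exprM natrM.
have := lb (2 ^ k)%N; have : 0 < (2 ^ k)%:R :> R by rewrite ltr0n expn_gt0.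
move: (x ^+ _) ((2 ^ k)%:R) kC => u m kC m0 mu; apply/negP; rewrite -ltNge.
have : (m * (x - 1)) ^+ 2 <= u ^+ 2.
  have p0 : 0 <= m * (x - 1) by rewrite ltW // mulr_gt0.
  by rewrite ler_sqr ?nnegrE //; apply: le_trans mu.
rewrite exprMn; nra.
Qed.

(** * Coefficients of a polynomial from its values on the unit circle *)

Section FourierCoefficients.
Variable R : realType.

(** X^n - 1 is separable in characteristic 0, so over a closed field it has n distinct roots; that
    many n-th roots of unity force a primitive one. *)
Lemma prim_root_exists n : (0 < n)%N -> exists z : R[i], n.-primitive_root z.
Proof.
move=> n0; pose p : {poly R[i]} := 'X^n - 1.
have [r Dp] := closed_field_poly_normal p.
rewrite (monicP _) ?monicXnsubC // scale1r in Dp.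
have rn1 : all n.-unity_root r by apply/allP=> z; rewrite -root_prod_XsubC -Dp.
have sz_r : (n < (size r).+1)%N.
  by rewrite -(size_prod_XsubC r id) -Dp size_XnsubC.
have [|z] := hasP (has_prim_root n0 rn1 _ sz_r); last by exists z.
by rewrite -separable_prod_XsubC -Dp separable_Xn_sub_1 // pnatr_eq0 -lt0n.
Qed.

(** A Cauchy estimate without integrals: averaging Q(z^j) z^(-jl) over the m-th roots of unity
    isolates the coefficient of index l exactly, because m = [size Q] exceeds every index. *)
Lemma coef_le_sup_unit_circle (Q : {poly R[i]}) (M : R[i]) :
  (forall z, `|z| = 1 -> `|Q.[z]| <= M) -> forall l, `|Q`_l| <= M.
Proof.
move=> QM l; have [ls|sl] := ltnP l (size Q); last first.
  rewrite nth_default // normr0.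
  by apply: le_trans (QM 1 (normr1 _)); exact: normr_ge0.
set m := size Q in ls.
have m0 : (0 < m)%N by apply: leq_ltn_trans ls.
have [z zp] := prim_root_exists m0.
have zn1 : `|z| = 1.
  by apply/eqP; rewrite -(@pexpr_eq1 _ _ m) // -normrX (prim_expr_order zp) normr1.
have z0 : z != 0 by rewrite -normr_eq0 zn1 oner_eq0.
have key : \sum_(j < m) Q.[z ^+ j] * z ^- (j * l) = m%:R * Q`_l.
  under eq_bigr => j _ do rewrite horner_coef mulr_suml.
  rewrite exchange_big (bigD1 (Ordinal ls)) //= [X in _ + X]big1 ?addr0.
    under eq_bigr => j _ do rewrite -exprM -mulrA mulfV ?mulr1 ?expf_neq0 //.
    by rewrite sumr_const card_ord mulr_natl.
  move=> k kl; under eq_bigr => j _ do rewrite -mulrA.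
  rewrite -mulr_sumr.
  (* Every other index contributes a geometric sum of ratio z^(k - l), which differs from 1 since k
     and l are distinct and below m; that sum vanishes. *)
  have w1 : z ^+ k * z ^- l != 1.
    apply: contra kl => /eqP h; apply/eqP/val_inj => /=.
    have : z ^+ k == z ^+ l.
      by rewrite -[z ^+ l]mul1r -h mulfVK // expf_neq0.
    by rewrite (eq_prim_root_expr zp) /eqn !modn_small // => /eqP.
  rewrite (_ : \sum_(i < m) _ = \sum_(i < m) (z ^+ k * z ^- l) ^+ i); last first.
    by apply: eq_bigr => j _; rewrite exprMn exprVn -!exprM mulnC [(l * j)%N]mulnC.
  have := subrX1 (z ^+ k * z ^- l) m.
  rewrite exprMn exprVn -!exprM ![(_ * m)%N]mulnC !exprM (prim_expr_order zp).
  rewrite !expr1n invr1 mulr1 subrr => /esym/eqP; rewrite mulf_eq0 subr_eq0.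
  by rewrite (negbTE w1) => /eqP ->; rewrite mulr0.
have : `|m%:R * Q`_l| <= m%:R * M.
  rewrite -key (le_trans (ler_norm_sum _ _ _)) //.
  rewrite -[m in leRHS]card_ord -sumr_const mulr_suml ler_sum // => j _.
  rewrite normrM normfV !normrX zn1 !expr1n invr1 mulr1 mul1r.
  by apply: QM; rewrite normrX zn1 expr1n.
by rewrite normrM normr_nat ler_pM2l // ltr0n.
Qed.

End FourierCoefficients.

(** * Real-valued norms and the unitization *)

Section RealNorm.
Variable R : realType.

(** The norm takes values in [R[i]], whose order is partial; this real copy is open to [lra] and
    [nra]. *)
Definition rnorm (V : normedZmodType R[i]) (x : V) : R := complex.Re `|x|.

Lemma rnormE (V : normedZmodType R[i]) (x : V) : `|x| = (rnorm x)%:C.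
Proof. by rewrite /rnorm RRe_real // ger0_real. Qed.

Section NormedZmod.
Variable V : normedZmodType R[i].
Implicit Types x y : V.

Lemma rnorm_ge0 x : 0 <= rnorm x.
Proof. by rewrite -ler0c -rnormE. Qed.

Lemma rnormD x y : rnorm (x + y) <= rnorm x + rnorm y.
Proof. by rewrite -lecR real_complexD -!rnormE ler_normD. Qed.

Lemma rnormN x : rnorm (- x) = rnorm x.
Proof. by rewrite /rnorm normrN. Qed.

Lemma rnormB x y : rnorm (x - y) <= rnorm x + rnorm y.
Proof. by rewrite -(rnormN y) rnormD. Qed.

Lemma rnorm_distC x y : rnorm (x - y) = rnorm (y - x).
Proof. by rewrite -rnormN opprB. Qed.

Lemma rnorm_triangle z x y : rnorm (x - y) <= rnorm (x - z) + rnorm (z - y).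
Proof. by rewrite -[x - y](subrKA z) rnormD. Qed.

Lemma rnorm0 : rnorm (0 : V) = 0.
Proof. by rewrite /rnorm normr0. Qed.

Lemma rnorm0_eq0 x : rnorm x = 0 -> x = 0.
Proof. by move=> x0; apply/normr0_eq0; rewrite rnormE x0. Qed.

Lemma rnorm_eps_eq x y : (forall e, 0 < e -> rnorm (x - y) <= e) -> x = y.
Proof.
move=> h; apply/subr0_eq/rnorm0_eq0/le_anti; rewrite rnorm_ge0 andbT.
by apply/ler_addgt0Pl => e e0; rewrite addr0 h.
Qed.

Lemma rnorm_sum (I : Type) (s : seq I) (P : pred I) (F : I -> V) :
  rnorm (\sum_(i <- s | P i) F i) <= \sum_(i <- s | P i) rnorm (F i).
Proof.
elim/big_ind2 : _ => [|x a y b xa yb|//]; first by rewrite rnorm0.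
by rewrite (le_trans (rnormD _ _)) // lerD.
Qed.

End NormedZmod.

Lemma rnormM (x y : R[i]) : rnorm (x * y) = rnorm x * rnorm y.
Proof. by apply: (@complexI R); rewrite real_complexM -!rnormE normrM. Qed.

Lemma rnormZ (V : normedModType R[i]) (k : R[i]) (x : V) :
  rnorm (k *: x) = rnorm k * rnorm x.
Proof. by apply: (@complexI R); rewrite real_complexM -!rnormE normrZ. Qed.

Lemma rnorm_real (r : R) : rnorm r%:C = `|r|.
Proof. by rewrite /rnorm normc_def /= expr0n addr0 sqrtr_sqr. Qed.

Lemma rnorm_conj (x : R[i]) : rnorm x^* = rnorm x.
Proof. by rewrite /rnorm norm_conjC. Qed.

Lemma rnormc_Re (x : R[i]) : `|complex.Re x| <= rnorm x.
Proof. by rewrite -lecR -rnormE normc_ge_Re. Qed.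

Lemma rnorm1c : rnorm (1 : R[i]) = 1.
Proof. by rewrite rnorm_real normr1. Qed.

Lemma rnorm_rotate (z : R[i]) :
  exists2 w : R[i], rnorm w = 1 & w * z = (rnorm z)%:C.
Proof.
have [->|z0] := eqVneq z 0; first by exists 1; rewrite ?rnorm1c // rnorm0 mulr0.
have n0 : rnorm z != 0 by apply: contra_neq z0; exact: rnorm0_eq0.
exists (z^* * ((rnorm z)^-1)%:C).
  by rewrite rnormM rnorm_conj rnorm_real ger0_norm ?invr_ge0 ?rnorm_ge0 // divff.
rewrite mulrAC mulrC [z^* * z]mulrC -normCK rnormE -rmorphXn -rmorphM /=.
by congr (_%:C); rewrite expr2 mulrA mulVf // mul1r.
Qed.

Lemma rnorm_complete (V : completeNormedModType R[i]) (u : nat -> V) :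
  (forall e, 0 < e -> exists N, forall m n, (N <= m)%N -> (N <= n)%N ->
    rnorm (u m - u n) <= e) ->
  exists l, forall e, 0 < e -> exists N, forall n, (N <= n)%N ->
    rnorm (u n - l) <= e.
Proof.
move=> uc.
have /cauchy_cvgP/cvg_ex[l ul] : cauchy (u @ \oo).
  apply/cauchy_ballP => e e0.
  have eE : e = (complex.Re e)%:C by rewrite RRe_real // gtr0_real.
  have e0' : 0 < complex.Re e by rewrite -ltcR -eE.
  have [|N uN] := uc (complex.Re e / 2); first by rewrite divr_gt0.
  exists (u @` [set n | (N <= n)%N], u @` [set n | (N <= n)%N]).
    by split; exists N => // n Nn; exists n.
  move=> [_ _] [[m /= Nm <-] [n /= Nn <-]]; rewrite -ball_normE /= rnormE eE ltcR.
  by apply: (@le_lt_trans _ _ (complex.Re e / 2)); [exact: uN | lra].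
exists l => e e0; move/cvgrPdist_le : ul => /(_ e%:C).
rewrite ltcR => /(_ e0) [N _ uN]; exists N => n Nn.
by rewrite rnorm_distC -lecR -rnormE uN.
Qed.

Lemma blin_rnorm_le (E F : normedModType R[i]) (f : {blin E -> F}) x :
  rnorm (f x) <= rnorm f * rnorm x.
Proof. by rewrite -lecR real_complexM -!rnormE blin_norm_le. Qed.

Lemma blin_rnorm_ub (E F : normedModType R[i]) (f : {blin E -> F}) (M : R) :
  0 <= M -> (forall x, rnorm (f x) <= M * rnorm x) -> rnorm f <= M.
Proof.
move=> M0 fM; rewrite -lecR -rnormE; apply: blin_norm_leP => [|x].
  by rewrite ler0c.
by rewrite !rnormE -real_complexM lecR.
Qed.

End RealNorm.

Section BlinMorphism.
Variables (R : realType) (E F : normedModType R[i]) (f : {blin E -> F}).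

Lemma blin_add x y : f (x + y) = f x + f y. Proof. exact: linearD. Qed.
Lemma blin_sub x y : f (x - y) = f x - f y. Proof. exact: linearB. Qed.
Lemma blin_zero : f 0 = 0. Proof. exact: linear0. Qed.
Lemma blin_scale k x : f (k *: x) = k *: f x. Proof. exact: linearZ. Qed.

End BlinMorphism.

Section CStarBasics.
Variables (R : realType) (A : cstarAlgType R).
Implicit Types (a b c : A) (k : R[i]).

Lemma cmul0r a : a ** 0 = 0.
Proof. by have := cmulZr (0 : R[i]) a (0 : A); rewrite !scale0r. Qed.
Lemma cmul0l a : 0 ** a = 0.
Proof. by have := cmulZl (0 : R[i]) (0 : A) a; rewrite !scale0r. Qed.
Lemma cmulNr a b : a ** (- b) = - (a ** b).
Proof. by rewrite -scaleN1r cmulZr scaleN1r. Qed.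
Lemma cmulNl a b : (- a) ** b = - (a ** b).
Proof. by rewrite -scaleN1r cmulZl scaleN1r. Qed.
Lemma cmulBr a b c : a ** (b - c) = a ** b - a ** c.
Proof. by rewrite cmulDr cmulNr. Qed.
Lemma cmulBl a b c : (a - b) ** c = a ** c - b ** c.
Proof. by rewrite cmulDl cmulNl. Qed.

Lemma cstar0 : cstar (0 : A) = 0.
Proof. by have := cstarZ (0 : R[i]) (0 : A); rewrite conjC0 !scale0r. Qed.
Lemma cstarN a : cstar (- a) = - cstar a.
Proof. by rewrite -scaleN1r cstarZ conjCN1 scaleN1r. Qed.
Lemma cstarB a b : cstar (a - b) = cstar a - cstar b.
Proof. by rewrite cstarD cstarN. Qed.

Lemma crnormM a b : rnorm (a ** b) <= rnorm a * rnorm b.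
Proof. by rewrite -lecR real_complexM -!rnormE cnormM. Qed.

Lemma crnorm_star_mul a : rnorm (cstar a ** a) = rnorm a ^+ 2.
Proof.
by apply: (@complexI R); rewrite expr2 real_complexM -!rnormE cnorm_star_mul expr2.
Qed.

(** From |b|^2 = |b* b| <= |b*| |b|, used for a and for its adjoint. *)
Lemma crnorm_star a : rnorm (cstar a) = rnorm a.
Proof.
suff h b : rnorm b <= rnorm (cstar b) by apply/le_anti; rewrite h -{2}(cstarK a) h.
have [b0|b0] := eqVneq (rnorm b) 0; first by rewrite b0 rnorm_ge0.
have b_gt0 : 0 < rnorm b by rewrite lt0r b0 rnorm_ge0.
by rewrite -(ler_pM2r b_gt0) -expr2 -crnorm_star_mul crnormM.
Qed.

Lemma crnorm_mul_star a : rnorm (a ** cstar a) = rnorm a ^+ 2.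
Proof. by rewrite -{1}(cstarK a) crnorm_star_mul crnorm_star. Qed.

(** Take b = a*, for which |a a*| = |a|^2. This cancellation stands in for an identity of the
    algebra. *)
Lemma cmul_left_faithful a : (forall b, a ** b = 0) -> a = 0.
Proof.
move=> h; apply: rnorm0_eq0; apply/eqP; rewrite -sqrf_eq0 -crnorm_mul_star h.
by rewrite rnorm0.
Qed.

Lemma rnorm_orthogonal a b : cstar a ** b = 0 ->
  rnorm (a + b) ^+ 2 <= rnorm a ^+ 2 + rnorm b ^+ 2.
Proof.
move=> ab; have ba : cstar b ** a = 0 by rewrite -[LHS]cstarK cstarM cstarK ab cstar0.
rewrite -!crnorm_star_mul cstarD cmulDl !cmulDr ab ba addr0 add0r.
exact: rnormD.
Qed.

End CStarBasics.

(** * The unitization and its two norms *)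

Definition unitz (R : realType) (A : cstarAlgType R) : Type := (R[i] * A)%type.

HB.instance Definition _ (R : realType) (A : cstarAlgType R) :=
  GRing.Lmodule.copy (unitz A) (R[i] * A)%type.

Section Unitization.
Variables (R : realType) (A : cstarAlgType R).
Local Notation U := (unitz A).
Implicit Types (x y z : U) (a b c : A) (k : R[i]).

Definition umul x y : U := (x.1 * y.1, x.1 *: y.2 + y.1 *: x.2 + x.2 ** y.2).
Definition uone : U := (1, 0).

Lemma unitz_eq x y : x.1 = y.1 -> x.2 = y.2 -> x = y.
Proof. by case: x y => [x1 x2] [y1 y2] /= -> ->. Qed.

Lemma umulA : associative umul.
Proof.
move=> x y z; apply: unitz_eq => /=; first by rewrite mulrA.
rewrite !scalerDr !cmulDr !cmulDl !cmulZl !cmulZr !scalerA cmulA !addrA.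
rewrite [z.1 * x.1]mulrC [z.1 * y.1]mulrC.
by rewrite [LHS](+%R.[ACl 1*2*4*6*3*5*7]).
Qed.
Lemma umul1l : left_id uone umul.
Proof.
move=> x; apply: unitz_eq => /=; first by rewrite mul1r.
by rewrite scale1r scaler0 cmul0l !addr0.
Qed.
Lemma umul1r : right_id uone umul.
Proof.
move=> x; apply: unitz_eq => /=; first by rewrite mulr1.
by rewrite scale1r scaler0 cmul0r add0r addr0.
Qed.
Lemma umulDl : left_distributive umul +%R.
Proof.
move=> x y z; apply: unitz_eq => /=; first by rewrite mulrDl.
by rewrite scalerDl scalerDr cmulDl !addrA [LHS](+%R.[ACl 1*3*5*2*4*6]).
Qed.
Lemma umulDr : right_distributive umul +%R.
Proof.
move=> x y z; apply: unitz_eq => /=; first by rewrite mulrDr.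
by rewrite scalerDl scalerDr cmulDr !addrA [LHS](+%R.[ACl 1*3*5*2*4*6]).
Qed.
Lemma uone_neq0 : uone != 0.
Proof. by apply/eqP => -[/eqP]; rewrite oner_eq0. Qed.

HB.instance Definition _ := GRing.Zmodule_isNzRing.Build U
  umulA umul1l umul1r umulDl umulDr uone_neq0.

Lemma uscaleAl k x y : k *: (x * y) = (k *: x) * y.
Proof.
apply: unitz_eq => /=; first by rewrite [LHS]mulrA.
by rewrite !scalerDr !cmulZl !scalerA [y.1 * k]mulrC.
Qed.
Lemma uscaleAr k x y : k *: (x * y) = x * (k *: y).
Proof.
apply: unitz_eq => /=; first by rewrite [LHS]mulrCA.
by rewrite !scalerDr !cmulZr !scalerA [x.1 * k]mulrC.
Qed.

HB.instance Definition _ := GRing.Lmodule_isLalgebra.Build R[i] U uscaleAl.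
HB.instance Definition _ := GRing.Lalgebra_isAlgebra.Build R[i] U uscaleAr.

End Unitization.

Section UnitizationTheory.
Variables (R : realType) (A : cstarAlgType R).
Local Notation U := (unitz A).
Implicit Types (x y z : U) (a b c : A) (k : R[i]).

Definition uemb a : U := (0, a).
Definition ustar x : U := (x.1^*, cstar x.2).
(** [A] is a two-sided ideal of its unitization; [lact x a] and [ract a x] are the products x a and
    a x, taken in [A]. *)
Definition lact x a : A := x.1 *: a + x.2 ** a.
Definition ract a x : A := x.1 *: a + a ** x.2.

Lemma umul1E x y : (x * y).1 = x.1 * y.1. Proof. by []. Qed.
Lemma umul2E x y : (x * y).2 = x.1 *: y.2 + y.1 *: x.2 + x.2 ** y.2.
Proof. by []. Qed.

Lemma ustarD x y : ustar (x + y) = ustar x + ustar y.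
Proof. by apply: unitz_eq => /=; rewrite ?rmorphD ?cstarD. Qed.
Lemma ustarZ k x : ustar (k *: x) = k^* *: ustar x.
Proof. by apply: unitz_eq => /=; rewrite ?cstarZ // [LHS]rmorphM. Qed.
Lemma ustarN x : ustar (- x) = - ustar x.
Proof. by rewrite -scaleN1r ustarZ conjCN1 scaleN1r. Qed.
Lemma ustarB x y : ustar (x - y) = ustar x - ustar y.
Proof. by rewrite ustarD ustarN. Qed.
Lemma ustarM x y : ustar (x * y) = ustar y * ustar x.
Proof.
apply: unitz_eq => /=; first by rewrite rmorphM mulrC.
by rewrite !cstarD !cstarZ cstarM [_ *: _ + _]addrC.
Qed.
Lemma ustarK : involutive ustar.
Proof. by move=> x; apply: unitz_eq => /=; rewrite ?conjCK ?cstarK. Qed.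
Lemma ustar1 : ustar 1 = 1.
Proof. by apply: unitz_eq => /=; rewrite ?conjC1 ?cstar0. Qed.
Lemma uembM a b : uemb (a ** b) = uemb a * uemb b.
Proof. by apply: unitz_eq; rewrite /= ?mul0r // !scale0r !add0r. Qed.
Lemma ustar_emb a : ustar (uemb a) = uemb (cstar a).
Proof. by apply: unitz_eq => //=; rewrite conjC0. Qed.

Lemma lactD x y a : lact (x + y) a = lact x a + lact y a.
Proof. by rewrite /lact /= scalerDl cmulDl addrACA. Qed.
Lemma lactZ k x a : lact (k *: x) a = k *: lact x a.
Proof. by rewrite /lact /= cmulZl scalerDr scalerA. Qed.
Lemma lactDr x a b : lact x (a + b) = lact x a + lact x b.
Proof. by rewrite /lact scalerDr cmulDr addrACA. Qed.
Lemma lactZr k x a : lact x (k *: a) = k *: lact x a.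
Proof. by rewrite /lact cmulZr scalerDr !scalerA mulrC. Qed.
Lemma lact0r x : lact x 0 = 0.
Proof. by rewrite /lact scaler0 cmul0r addr0. Qed.
Lemma lactM x y a : lact (x * y) a = lact x (lact y a).
Proof.
rewrite /lact umul1E umul2E !scalerDr !cmulDl !cmulDr !cmulZl !cmulZr !scalerA cmulA.
by rewrite !addrA.
Qed.
Lemma lact1 a : lact 1 a = a.
Proof. by rewrite /lact /= scale1r cmul0l addr0. Qed.
Lemma lact_emb a b : lact (uemb a) b = a ** b.
Proof. by rewrite /lact /= scale0r add0r. Qed.
Lemma uemb_lact x a : uemb (lact x a) = x * uemb a.
Proof.
by apply: unitz_eq; rewrite ?umul1E ?umul2E /= ?mulr0 // scale0r addr0.
Qed.
Lemma lact_cmul x a b : lact x (a ** b) = lact x a ** b.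
Proof. by rewrite /lact cmulDl cmulZl cmulA. Qed.

Lemma ractE a x : ract a x = cstar (lact (ustar x) (cstar a)).
Proof. by rewrite /ract /lact cstarD cstarZ cstarM !cstarK conjCK. Qed.
Lemma cstar_lact x a : cstar (lact x a) = ract (cstar a) (ustar x).
Proof. by rewrite ractE ustarK cstarK. Qed.
Lemma ractD a x y : ract a (x + y) = ract a x + ract a y.
Proof. by rewrite /ract /= scalerDl cmulDr addrACA. Qed.
Lemma ractZ a k x : ract a (k *: x) = k *: ract a x.
Proof. by rewrite /ract /= cmulZr scalerDr scalerA. Qed.
Lemma ractM a x y : ract a (x * y) = ract (ract a x) y.
Proof. by rewrite !ractE ustarM lactM cstarK. Qed.
Lemma ract1 a : ract a 1 = a.
Proof. by rewrite ractE ustar1 lact1 cstarK. Qed.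
Lemma ract_emb a b : ract a (uemb b) = a ** b.
Proof. by rewrite /ract /= scale0r add0r. Qed.
Lemma ract_lact a x b : ract a x ** b = a ** lact x b.
Proof. by rewrite /ract /lact cmulDl cmulDr cmulZl cmulZr cmulA. Qed.

Lemma cmul_ract a b x : a ** ract b x = ract (a ** b) x.
Proof. by rewrite /ract cmulDr cmulZr cmulA. Qed.

Lemma lact_linear x : linear (lact x).
Proof. by move=> k a b; rewrite lactDr lactZr. Qed.
Lemma lact_bound x a : rnorm (lact x a) <= (rnorm x.1 + rnorm x.2) * rnorm a.
Proof.
by rewrite (le_trans (rnormD _ _)) // mulrDl lerD ?crnormM // rnormZ.
Qed.
Lemma lact_bounded x : bounded_op (lact x).
Proof.
exists (rnorm x.1 + rnorm x.2) => a.
by rewrite !rnormE -real_complexM lecR lact_bound.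
Qed.
Definition lact_op x : {blin A -> A} := BLin (lact_linear x) (lact_bounded x).

(* A C*-seminorm on the unitization: it is not a norm when [A] is unital, so
   limits are taken for the Banach algebra norm [uB] below. *)
Definition uN x : R := rnorm (lact_op x).
Definition uB x : R := rnorm x.1 + rnorm x.2.

Lemma uN_ge0 x : 0 <= uN x. Proof. exact: rnorm_ge0. Qed.
Lemma uB_ge0 x : 0 <= uB x. Proof. by rewrite addr_ge0 ?rnorm_ge0. Qed.

Lemma uN_le x a : rnorm (lact x a) <= uN x * rnorm a.
Proof. exact: (@blin_rnorm_le R A A (lact_op x)). Qed.

Lemma uN_ub x M : 0 <= M -> (forall a, rnorm (lact x a) <= M * rnorm a) -> uN x <= M.
Proof. by move=> M0 h; apply: (@blin_rnorm_ub R A A (lact_op x)). Qed.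

Lemma uN_uB x : uN x <= uB x.
Proof. by apply: uN_ub => [|a]; [exact: uB_ge0 | exact: lact_bound]. Qed.

Lemma uND x y : uN (x + y) <= uN x + uN y.
Proof.
apply: uN_ub => [|a]; first by rewrite addr_ge0 ?uN_ge0.
by rewrite lactD (le_trans (rnormD _ _)) // mulrDl lerD ?uN_le.
Qed.

Lemma uNM x y : uN (x * y) <= uN x * uN y.
Proof.
apply: uN_ub => [|a]; first by rewrite mulr_ge0 ?uN_ge0.
by rewrite lactM (le_trans (uN_le _ _)) // -mulrA ler_wpM2l ?uN_ge0 ?uN_le.
Qed.

Lemma uNZ k x : uN (k *: x) <= rnorm k * uN x.
Proof.
apply: uN_ub => [|a]; first by rewrite mulr_ge0 ?uN_ge0 ?rnorm_ge0.
by rewrite lactZ rnormZ -mulrA ler_wpM2l ?rnorm_ge0 ?uN_le.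
Qed.

Lemma uN1 : uN 1 <= 1.
Proof. by apply: uN_ub => // a; rewrite lact1 mul1r. Qed.

Lemma uN0 : uN 0 = 0.
Proof.
by apply/le_anti; rewrite uN_ge0 (le_trans (uN_uB _)) // /uB !rnorm0 addr0.
Qed.

Lemma uNB x y : uN (x - y) <= uN x + uN y.
Proof.
rewrite (le_trans (uND _ _)) // lerD2l -scaleN1r (le_trans (uNZ _ _)) //.
by rewrite rnormN rnorm1c mul1r.
Qed.

Lemma uNX x n : uN x <= 1 -> uN (x ^+ n) <= 1.
Proof.
move=> x1; elim: n => [|n IH]; first by rewrite expr0 uN1.
by rewrite exprS (le_trans (uNM _ _)) // mulr_ile1 ?uN_ge0.
Qed.

Lemma uN_sum (I : Type) (s : seq I) (P : pred I) (F : I -> U) :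
  uN (\sum_(i <- s | P i) F i) <= \sum_(i <- s | P i) uN (F i).
Proof.
elim/big_ind2 : _ => [|x a y b xa yb|//]; first by rewrite uN0.
by rewrite (le_trans (uND _ _)) // lerD.
Qed.

Lemma uN_emb a : uN (uemb a) = rnorm a.
Proof.
apply/le_anti/andP; split.
  by apply: uN_ub => [|b]; [exact: rnorm_ge0 | rewrite lact_emb crnormM].
have [a0|a0] := eqVneq (rnorm a) 0; first by rewrite a0 uN_ge0.
have a_gt0 : 0 < rnorm a by rewrite lt0r a0 rnorm_ge0.
rewrite -(ler_pM2r a_gt0) -expr2 -crnorm_mul_star -lact_emb (le_trans (uN_le _ _)) //.
by rewrite crnorm_star.
Qed.

(** Tested on a: |x a|^2 = |a* (x* x a)| <= |a| |x* x a|, the usual argument for operators on a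
    Hilbert space. *)
Lemma uN_star_mul x : uN x ^+ 2 <= uN (ustar x * x).
Proof.
have h0 := uN_ge0 (ustar x * x).
rewrite -(sqr_sqrtr h0) ler_sqr ?nnegrE ?uN_ge0 ?sqrtr_ge0 //.
apply: uN_ub => [|a]; first exact: sqrtr_ge0.
rewrite -ler_sqr ?nnegrE ?rnorm_ge0 ?mulr_ge0 ?rnorm_ge0 ?sqrtr_ge0 //.
rewrite exprMn sqr_sqrtr // -crnorm_star_mul cstar_lact ract_lact -lactM.
rewrite (le_trans (crnormM _ _)) // crnorm_star mulrC expr2 mulrA ler_wpM2r ?rnorm_ge0 //.
exact: uN_le.
Qed.

Lemma uN_star x : uN (ustar x) = uN x.
Proof.
suff h y : uN y <= uN (ustar y) by apply/le_anti; rewrite h -{2}(ustarK x) h.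
have [b0|b0] := eqVneq (uN y) 0; first by rewrite b0 uN_ge0.
have b_gt0 : 0 < uN y by rewrite lt0r b0 uN_ge0.
by rewrite -(ler_pM2r b_gt0) -expr2 (le_trans (uN_star_mul _)) // uNM.
Qed.

Lemma uN_ract x a : rnorm (ract a x) <= uN x * rnorm a.
Proof. by rewrite ractE crnorm_star (le_trans (uN_le _ _)) // uN_star crnorm_star. Qed.

Lemma uBD x y : uB (x + y) <= uB x + uB y.
Proof. by rewrite /uB /= addrACA lerD ?rnormD. Qed.

Lemma uBN x : uB (- x) = uB x.
Proof. by rewrite /uB /= !rnormN. Qed.

Lemma uBB x y : uB (x - y) <= uB x + uB y.
Proof. by rewrite (le_trans (uBD _ _)) // uBN. Qed.

Lemma uB_distC x y : uB (x - y) = uB (y - x).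
Proof. by rewrite -uBN opprB. Qed.

Lemma uB_triangle z x y : uB (x - y) <= uB (x - z) + uB (z - y).
Proof. by rewrite -[x - y](subrKA z) uBD. Qed.

Lemma uBZ k x : uB (k *: x) = rnorm k * uB x.
Proof. by rewrite /uB mulrDr -rnormM -rnormZ. Qed.

Lemma uBM x y : uB (x * y) <= uB x * uB y.
Proof.
have h1 := rnormD (x.1 *: y.2 + y.1 *: x.2) (x.2 ** y.2).
have h2 := rnormD (x.1 *: y.2) (y.1 *: x.2); rewrite !rnormZ in h2.
have h3 := crnormM x.2 y.2.
by rewrite /uB umul1E umul2E rnormM mulrDr !mulrDl; lra.
Qed.

Lemma uB_star x : uB (ustar x) = uB x.
Proof. by rewrite /uB /= rnorm_conj crnorm_star. Qed.

Lemma uB_eps_eq x y : (forall e, 0 < e -> uB (x - y) <= e) -> x = y.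
Proof.
move=> h; apply: unitz_eq; apply: rnorm_eps_eq => e e0;
  by apply: le_trans (h e e0); rewrite /uB ?lerDl ?lerDr rnorm_ge0.
Qed.

(** Only the component in [A] appeals to completeness; the scalar limit is supplied from outside,
    and in the functional calculus it is f(0). *)
Lemma uB_limit (c : R[i]) (u : nat -> U) :
  (forall e, 0 < e -> exists N, forall n, (N <= n)%N -> rnorm ((u n).1 - c) <= e) ->
  (forall e, 0 < e -> exists N, forall m n, (N <= m)%N -> (N <= n)%N ->
    uB (u m - u n) <= e) ->
  exists2 l : U, l.1 = c &
    forall e, 0 < e -> exists N, forall n, (N <= n)%N -> uB (u n - l) <= e.
Proof.
move=> uc uB_cauchy.
have [|l ul] := @rnorm_complete R A (fun n => (u n).2).
  move=> e /uB_cauchy[N uN]; exists N => m n Nm Nn.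
  by apply: le_trans (uN m n Nm Nn); rewrite /uB lerDr rnorm_ge0.
exists (c, l) => // e e0; have e20 : 0 < e / 2 by rewrite divr_gt0.
have [N1 h1] := uc _ e20; have [N2 h2] := ul _ e20.
exists (maxn N1 N2) => n; rewrite geq_max => /andP[/h1 n1 /h2 n2].
by rewrite /uB /=; lra.
Qed.

End UnitizationTheory.

(** * Self-adjoint elements as real parts of unitaries *)

Lemma half_expn_small (R : realType) (C e : R) : 0 < e ->
  exists N, forall n, (N <= n)%N -> C * 2^-1 ^+ n <= e.
Proof.
move=> e0; exists (Num.truncn (`|C| / e)).+1 => n Nn.
have h : `|C| / e <= 2 ^+ n.
  apply: ltW; apply: lt_le_trans (truncnS_gt _) _.
  by rewrite -natrX ler_nat (leq_trans Nn) // ltnW // ltn_expl.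
rewrite exprVn ler_pdivrMr ?exprn_gt0 // (le_trans (ler_norm _)) //.
by rewrite mulrC -ler_pdivrMr.
Qed.

Lemma rnorm_geometric_limit (R : realType) (V : completeNormedModType R[i])
    (u : nat -> V) (C : R) :
  (forall n, rnorm (u n.+1 - u n) <= C * 2^-1 ^+ n.+1) ->
  exists l, forall n, rnorm (u n - l) <= C * 2^-1 ^+ n.
Proof.
move=> uC.
have C0 : 0 <= C.
  have := le_trans (rnorm_ge0 _) (uC 0%N); rewrite expr1; lra.
have step n k : rnorm (u (n + k)%N - u n) <= C * 2^-1 ^+ n - C * 2^-1 ^+ (n + k).
  elim: k => [|k IH]; first by rewrite addn0 !subrr rnorm0.
  have := rnorm_triangle (u (n + k)%N) (u (n + k.+1)%N) (u n).
  move=> /le_trans; apply; rewrite addnS; have := uC (n + k)%N.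
  rewrite exprS; move: IH; lra.
have le n m : (n <= m)%N -> rnorm (u m - u n) <= C * 2^-1 ^+ n.
  move=> /subnKC <-; apply: (le_trans (step _ _)).
  by rewrite gerBl mulr_ge0 // exprn_ge0.
have [|l ul] := @rnorm_complete R V u.
  move=> e e0; have [N hN] := half_expn_small C e0.
  exists N => m n Nm Nn; have [nm|mn] := leqP n m.
    exact: le_trans (le _ _ nm) (hN _ Nn).
  by rewrite rnorm_distC; exact: le_trans (le _ _ (ltnW mn)) (hN _ Nm).
exists l => n; apply/ler_addgt0Pl => e e0; have [N hN] := ul e e0.
have := rnorm_triangle (u (maxn N n)) (u n) l.
move=> /le_trans; apply; rewrite addrC lerD ?hN ?leq_maxl //.
by rewrite rnorm_distC le // leq_maxr.
Qed.

Section SquareRoot.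
Variables (R : realType) (A : cstarAlgType R) (h : A).
Hypothesis hS : cstar h = h.
Hypothesis h2 : rnorm h <= 2^-1.

(** A fixed point y of the iterated map satisfies (1 - y)^2 = 1 - h^2, so the limit is 1 - sqrt(1 -
    h^2), found inside [A]. For |h| <= 1/2 the map preserves the ball of radius 1/2 and shrinks the
    successive differences by 1/2. *)
Let s (n : nat) : A :=
  iter n (fun y => (2^-1 : R[i]) *: (h ** h + y ** y)) 0.

Let half2 : 2^-1 + 2^-1 = 1 :> R[i].
Proof. by field. Qed.

Let half_norm (V : normedModType R[i]) (x : V) :
  rnorm ((2^-1 : R[i]) *: x) = 2^-1 * rnorm x.
Proof.
rewrite rnormZ; congr (_ * _); have -> : (2^-1 : R[i]) = (2^-1 : R)%:C.
  by rewrite fmorphV rmorph_nat.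
by rewrite rnorm_real ger0_norm // invr_ge0.
Qed.

Let s_norm n : rnorm (s n) <= 2^-1.
Proof.
elim: n => [|n IH]; first by rewrite rnorm0 invr_ge0.
rewrite /= half_norm; have := rnormD (h ** h) (s n ** s n).
have := crnormM h h; have := crnormM (s n) (s n).
move: IH h2 (rnorm_ge0 (s n)) (rnorm_ge0 h); rewrite /s /=; nra.
Qed.

Let s_star n : cstar (s n) = s n.
Proof.
elim: n => [|n IH]; first exact: cstar0.
rewrite /= cstarZ cstarD !cstarM hS -/(s n) IH; congr (_ *: _).
by rewrite fmorphV rmorph_nat.
Qed.

Let s_comm n : s n ** h = h ** s n.
Proof.
elim: n => [|n IH]; first by rewrite cmul0l cmul0r.
rewrite /= cmulZl cmulZr -/(s n) cmulDl cmulDr -!cmulA IH; congr (_ *: (_ + _)).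
by rewrite cmulA IH -cmulA.
Qed.

Let s_step n : rnorm (s n.+1 - s n) <= 1 * 2^-1 ^+ n.+1.
Proof.
elim: n => [|n IH].
  rewrite /= subr0 cmul0r addr0 half_norm expr1.
  have := crnormM h h; move: h2 (rnorm_ge0 h); nra.
rewrite -[s n.+2]/((2^-1 : R[i]) *: (h ** h + s n.+1 ** s n.+1)).
rewrite -[X in _ - X]/((2^-1 : R[i]) *: (h ** h + s n ** s n)).
rewrite -scalerBr half_norm opprD addrACA subrr add0r.
rewrite (_ : _ - _ = s n.+1 ** (s n.+1 - s n) + (s n.+1 - s n) ** s n); last first.
  by rewrite cmulBr cmulBl addrA subrK.
rewrite exprS mul1r ler_pM2l ?invr_gt0 //.
apply: (le_trans (rnormD _ _)).
have := crnormM (s n.+1) (s n.+1 - s n); have := crnormM (s n.+1 - s n) (s n).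
move: IH (s_norm n) (s_norm n.+1) (rnorm_ge0 (s n.+1 - s n)); rewrite mul1r; nra.
Qed.

Lemma one_sub_sqrt :
  exists y : A, [/\ cstar y = y, y ** h = h ** y & y + y - y ** y = h ** h].
Proof.
have [y sy] := rnorm_geometric_limit s_step.
have small e (C : R) : 0 < e -> exists n, C * rnorm (s n - y) <= e /\
    C * rnorm (s n.+1 - y) <= e.
  move=> e0; have [N hN] := half_expn_small `|C| e0; exists N.
  have k n : (N <= n)%N -> C * rnorm (s n - y) <= e.
    move=> Nn; apply: le_trans (hN n Nn).
    rewrite (le_trans (ler_wpM2r (rnorm_ge0 _) (ler_norm C))) //.
    by rewrite ler_wpM2l // -[leRHS]mul1r sy.
  by split; apply: k.
have y2 : rnorm y <= 2^-1.
  apply/ler_addgt0Pl => e e0; have [n [hn _]] := small e 1 e0.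
  have := rnormB (s n) (s n - y); rewrite subKr; have := s_norm n.
  by move: hn; rewrite mul1r; lra.
exists y; split.
- apply: rnorm_eps_eq => e e0; have [n [hn _]] := small e 2 e0.
  apply: le_trans hn; apply: le_trans (rnorm_triangle (s n) _ _) _.
  by rewrite -{1}s_star -cstarB crnorm_star rnorm_distC; lra.
- apply: rnorm_eps_eq => e e0; have [n [hn _]] := small e 1 e0.
  apply: le_trans hn; rewrite mul1r.
  have -> : y ** h - h ** y = h ** (s n - y) - (s n - y) ** h.
    by rewrite cmulBr cmulBl s_comm opprB [RHS]addrC addrA subrK.
  apply: le_trans (rnormB _ _) _.
  have := crnormM h (s n - y); have := crnormM (s n - y) h.
  by move: h2 (rnorm_ge0 (s n - y)); nra.
- apply: rnorm_eps_eq => e e0; have [n [hn hn1]] := small (e / 2) 2 ltac:(lra).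
  have E : h ** h = s n.+1 + s n.+1 - s n ** s n.
    by rewrite /= -/(s n) -scalerDl half2 scale1r addrK.
  rewrite E.
  have -> : y + y - y ** y - (s n.+1 + s n.+1 - s n ** s n) =
     (s n ** (s n - y) + (s n - y) ** y) - ((s n.+1 - y) + (s n.+1 - y)).
    rewrite cmulBr cmulBl addrA subrK !opprD !opprK !addrA.
    by rewrite [LHS](+%R.[ACl 6*3*4*1*5*2]).
  apply: le_trans (rnormB _ _) _.
  have t1 := rnormD (s n ** (s n - y)) ((s n - y) ** y).
  have t2 := rnormD (s n.+1 - y) (s n.+1 - y).
  have t3 := crnormM (s n) (s n - y); have t4 := crnormM (s n - y) y.
  by move: (rnorm_ge0 (s n - y)) (rnorm_ge0 (s n)) (s_norm n); nra.
Qed.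

(** u = h + i (1 - y), where 1 - y is a self-adjoint square root of 1 - h^2 commuting with h, so
    that u u* = u* u = h^2 + (1 - y)^2 = 1. *)
Lemma selfadjoint_unitary : exists u : unitz A,
  [/\ u * ustar u = 1, ustar u * u = 1 &
      uemb h = (2^-1 : R[i]) *: (u + ustar u)].
Proof.
have [y [yS yh yE]] := one_sub_sqrt.
pose s1 : unitz A := 1 - uemb y; pose H := uemb h.
have s1S : ustar s1 = s1 by rewrite ustarB ustar1 ustar_emb yS.
have HS : ustar H = H by rewrite ustar_emb hS.
have sH : s1 * H = H * s1.
  by rewrite mulrBl mulrBr mul1r mulr1 -!uembM yh.
have sq : H * H + s1 * s1 = 1.
  have -> : H * H = uemb y + uemb y - uemb y * uemb y.
    rewrite -!uembM -yE; apply: unitz_eq => //=.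
    by rewrite /= addr0 subr0.
  have -> : s1 * s1 = 1 - uemb y - uemb y + uemb y * uemb y.
    by rewrite /s1 mulrBl mul1r mulrBr mulr1 opprB addrA addrAC.
  rewrite !addrA [LHS](+%R.[ACl 4*1*5*2*6*7*3]).
  by rewrite !addrK.
pose j : R[i] := 'i.
have jj : j * j = -1 by rewrite -expr2 sqrCi.
have jS : j^* = - j by rewrite conjCi.
have uS : ustar (H + j *: s1) = H - j *: s1.
  by rewrite ustarD ustarZ HS s1S jS scaleNr.
exists (H + j *: s1); rewrite uS; split.
- rewrite mulrBr !mulrDl -!scalerAr -!scalerAl scalerA jj sH scaleN1r.
  by rewrite opprD opprK addrA addrK sq.
- rewrite mulrDr !mulrBl -!scalerAr -!scalerAl scalerA jj sH scaleN1r opprK.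
  by rewrite addrA subrK sq.
- by rewrite addrACA subrr addr0 scalerDr -scalerDl half2 scale1r.
Qed.

End SquareRoot.

(** * Functional calculus *)

Lemma horner_algZ (F : comNzRingType) (U : algType F) (u : U) (c : F) (Q : {poly F}) :
  horner_alg u (c *: Q) = c *: horner_alg u Q.
Proof. by rewrite -mul_polyC rmorphM /= horner_algC -scalerAl mul1r. Qed.

Lemma horner_algE (F : comNzRingType) (U : algType F) (u : U) (Q : {poly F}) :
  horner_alg u Q = \sum_(i < size Q) Q`_i *: u ^+ i.
Proof.
rewrite -{1}(coefK Q) poly_def rmorph_sum /=; apply: eq_bigr => i _.
by rewrite horner_algZ rmorphXn /= horner_algX.
Qed.

Section PolynomialCalculus.
Variables (R : realType) (A : cstarAlgType R) (h : A).
Local Notation U := (unitz A).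
Local Notation H := (uemb h).
Implicit Types (p q : {poly R}) (Q : {poly R[i]}).

Definition pcalc p : U := horner_alg H (map_poly (real_complex R) p).

Lemma pcalcD p q : pcalc (p + q) = pcalc p + pcalc q.
Proof. by rewrite /pcalc !rmorphD. Qed.
Lemma pcalcB p q : pcalc (p - q) = pcalc p - pcalc q.
Proof. by rewrite /pcalc !rmorphB. Qed.
Lemma pcalcM p q : pcalc (p * q) = pcalc p * pcalc q.
Proof. by rewrite /pcalc !rmorphM. Qed.
Lemma pcalcC (c : R) : pcalc c%:P = c%:C *: 1.
Proof. by rewrite /pcalc map_polyC horner_algC. Qed.
Lemma pcalc_X : pcalc 'X = H.
Proof. by rewrite /pcalc map_polyX horner_algX. Qed.
Lemma pcalcE p : pcalc p = \sum_(i < size p) (p`_i)%:C *: H ^+ i.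
Proof.
rewrite /pcalc horner_algE size_map_poly; apply: eq_bigr => i _.
by rewrite coef_map.
Qed.

Lemma pcalc1 p : (pcalc p).1 = (p.[0])%:C.
Proof.
elim/poly_ind: p => [|p c IH]; first by rewrite /pcalc !rmorph0 horner0.
rewrite pcalcD pcalcM pcalc_X pcalcC -[LHS]/((pcalc p).1 * 0 + c%:C * 1).
by rewrite !hornerE /= ?mulr0 ?add0r ?mulr1.
Qed.

Hypothesis hS : cstar h = h.

Lemma pcalc_star p : ustar (pcalc p) = pcalc p.
Proof.
have HS : ustar H = H by rewrite ustar_emb hS.
elim/poly_ind: p => [|p c IH].
  by rewrite /pcalc !rmorph0; apply: unitz_eq; rewrite /= ?conjC0 ?cstar0.
rewrite pcalcD pcalcM pcalc_X pcalcC ustarD ustarZ ustar1 ustarM IH HS.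
congr (_ + _ *: _); last by apply/CrealP/complex_realP; exists c.
by rewrite -{1}pcalc_X -pcalcM mulrC pcalcM pcalc_X.
Qed.

Hypothesis h2 : rnorm h <= 2^-1.

(** For the unitary u with real part h one has h = (u^2 + 1) / (2u). Multiplying p(h) by u^n, with n
    = [size p], clears the denominators and leaves this polynomial in u. Its degree is at most 2n,
    whence the factor 2n + 1 in the first norm estimate. *)
Let crude_degree p : {poly R[i]} :=
  \sum_(i < size p)
    ((p`_i)%:C / 2 ^+ i) *: (('X^2 + 1) ^+ i * 'X^(size p - i)).

Let size_crude p : (size (crude_degree p) <= 2 * size p + 1)%N.
Proof.
apply: (leq_trans (size_sum _ _ _)); apply/bigmax_leqP => i _.
apply: (leq_trans (size_scale_leq _ _)); apply: (leq_trans (size_polyMleq _ _)).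
rewrite size_polyXn.
have s2 : size ('X^2 + 1 : {poly R[i]}) = 3%N.
  by rewrite size_polyDl ?size_polyXn // size_poly1.
have ar (k n m : nat) : (k < n -> m <= (2 * k).+1 ->
  (m + (n - k).+1).-1 <= 2 * n + 1)%N by lia.
have := size_poly_exp_leq ('X^2 + 1 : {poly R[i]}) i; rewrite s2.
exact: ar (ltn_ord i).
Qed.

Let crude_circle p (z : R[i]) : `|z| = 1 ->
  (crude_degree p).[z] = z ^+ size p * (p.[complex.Re z])%:C.
Proof.
move=> z1; have zz : z ^+ 2 + 1 = z * (2 * (complex.Re z)%:C).
  by rewrite -addcJ mulrDr -expr2 -normCK z1 expr1n.
rewrite horner_sum horner_coef rmorph_sum mulr_sumr; apply: eq_bigr => i _.
rewrite !hornerE zz !exprMn rmorphM rmorphXn.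
have -> : z ^+ size p = z ^+ i * z ^+ (size p - i).
  by rewrite -exprD subnKC // ltnW.
have t0 : 2 ^+ i != 0 :> R[i] by rewrite expf_neq0 // pnatr_eq0.
by rewrite /=; field.
Qed.

Let pcalc_bound_size p (M : R) :
  (forall x, `|x| <= 1 -> `|p.[x]| <= M) ->
  uN (pcalc p) <= (2 * size p + 1)%:R * M.
Proof.
move=> pM.
have [u [uu1 uu2 uH]] := selfadjoint_unitary hS h2.
have M0 : 0 <= M by apply: le_trans (pM 0 _); rewrite ?normr0 ?normr_ge0.
have un : uN u <= 1.
  rewrite -(@expr_le1 _ 2) ?uN_ge0 // (le_trans (uN_star_mul _)) // uu2.
  exact: uN1.
have H2 : 2 *: H = u + ustar u by rewrite uH scalerA mulfV ?pnatr_eq0 // scale1r.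
have uHc : u * (2 *: H) = (2 *: H) * u.
  by rewrite H2 mulrDr mulrDl uu1 uu2.
have u2 : u ^+ 2 + 1 = u * (2 *: H) by rewrite H2 mulrDr uu1 expr2.
have uHc' : u * H = H * u.
  have -> : H = 2^-1 *: (2 *: H) by rewrite scalerA mulVf ?pnatr_eq0 // scale1r.
  by rewrite -scalerAr uHc scalerAl.
have Qu : horner_alg u (crude_degree p) = u ^+ size p * pcalc p.
  rewrite pcalcE mulr_sumr rmorph_sum /=; apply: eq_bigr => i _.
  rewrite horner_algZ rmorphM /= !rmorphXn /= rmorphD rmorph1 /= rmorphXn /= horner_algX u2.
  rewrite (exprMn_comm i uHc) exprZn -!scalerAr -!scalerAl scalerA mulfVK; last first.
    by rewrite expf_neq0 // pnatr_eq0.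
  congr (_ *: _); rewrite -mulrA (commrX _ (commr_sym (commrX i uHc'))) mulrA -exprD.
  by rewrite subnKC // ltnW.
have n1 : ustar u ^+ size p * u ^+ size p = 1.
  by rewrite -exprMn_comm ?uu2 ?expr1n // /GRing.comm uu1.
rewrite -[pcalc p]mul1r -n1 -mulrA -Qu (le_trans (uNM _ _)) //.
apply: (@le_trans _ _ (1 * uN (horner_alg u (crude_degree p)))).
  by rewrite ler_wpM2r ?uN_ge0 // uNX // uN_star.
rewrite mul1r horner_algE (le_trans (uN_sum _ _ _)) //.
have coefM l : rnorm (crude_degree p)`_l <= M.
  rewrite -lecR -rnormE; apply: coef_le_sup_unit_circle => z z1.
  rewrite crude_circle // normrM normrX z1 expr1n mul1r rnormE rnorm_real lecR.
  by apply: pM; rewrite (le_trans (rnormc_Re z)) // /rnorm z1.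
apply: (@le_trans _ _ (\sum_(i < size (crude_degree p)) M)).
  apply: ler_sum => i _; apply: (le_trans (uNZ _ _)).
  by rewrite -[leRHS]mulr1 ler_pM ?rnorm_ge0 ?uN_ge0 // uNX.
rewrite sumr_const card_ord -[leLHS]mulr_natl ler_wpM2r // ler_nat.
exact: size_crude.
Qed.

(** As p(h) is self-adjoint, the C*-inequality gives |p(h)|^m <= |p(h)^m| for m = 2^k. The factor
    that counts coefficients of p^m grows only linearly in m, so its m-th root tends to 1. *)
Lemma pcalc_bound p (M : R) : (forall x, `|x| <= 1 -> `|p.[x]| <= M) ->
  uN (pcalc p) <= M.
Proof.
move=> pM; apply/ler_addgt0Pl => e e0.
have M0 : 0 <= M by apply: le_trans (pM 0 _); rewrite ?normr0 ?normr_ge0.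
(* The slack e keeps N positive, so that one can divide by it even when M is 0. *)
pose N := e + M; have N0 : 0 < N by rewrite /N; lra.
rewrite -/N -[leRHS]mul1r -ler_pdivrMr //.
apply: (@exp_growth_le1 _ _ (2 * (size p)%:R + 3)).
  by rewrite divr_ge0 ?uN_ge0 // ltW.
move=> k; set m := (2 ^ k)%N.
have m0 : (0 < m)%N by rewrite expn_gt0.
have pow : uN (pcalc p) ^+ m <= uN (pcalc (p ^+ m)).
  rewrite /m; elim: k {m m0} => [|k IH]; first by rewrite !expr1.
  rewrite expnS mulnC !exprM.
  apply: (@le_trans _ _ (uN (pcalc (p ^+ (2 ^ k))) ^+ 2)).
    by rewrite ler_sqr ?nnegrE ?exprn_ge0 ?uN_ge0.
  have -> : pcalc (p ^+ (2 ^ k) ^+ 2) =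
      ustar (pcalc (p ^+ (2 ^ k))) * pcalc (p ^+ (2 ^ k)).
    by rewrite pcalc_star expr2 pcalcM.
  exact: uN_star_mul.
rewrite expr_div_n ler_pdivrMr ?exprn_gt0 //; apply: (le_trans pow).
have pmN x : `|x| <= 1 -> `|(p ^+ m).[x]| <= N ^+ m.
  move=> x1; rewrite horner_exp normrX lerXn2r ?nnegrE ?normr_ge0 ?(ltW N0) //.
  by rewrite (le_trans (pM x x1)) // /N lerDr ltW.
apply: (le_trans (pcalc_bound_size pmN)).
rewrite ler_wpM2r ?exprn_ge0 ?(ltW N0) //.
have sm : (2 * size (p ^+ m) + 1 <= (2 * size p + 3) * m)%N.
  have := size_poly_exp_leq p m; move: (size (p ^+ m)) (size p) => a b.
  have : (b.-1 * m <= b * m)%N by rewrite leq_mul2r leq_pred orbT.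
  by rewrite mulnDl -mulnA; lia.
by rewrite -natrM -natrD -natrM ler_nat.
Qed.

(** Passage from the seminorm to the complete norm: |p(0)| <= M, and p(h) - p(0) lies in [A], where
    [uN] is the norm, with value at most 2M. *)
Lemma pcalc_uB p (M : R) : (forall x, `|x| <= 1 -> `|p.[x]| <= M) ->
  uB (pcalc p) <= 3 * M.
Proof.
move=> pM; have p0 : `|p.[0]| <= M by apply: pM; rewrite normr0.
have pE : pcalc p - (p.[0])%:C *: 1 = uemb (pcalc p).2.
  apply: unitz_eq; first by rewrite -[LHS]/((pcalc p).1 - _ * 1) pcalc1 mulr1 subrr.
  by rewrite /= scaler0 subr0.
rewrite /uB pcalc1 rnorm_real -uN_emb -pE.
have t1 := uNB (pcalc p) ((p.[0])%:C *: 1); have t2 := pcalc_bound pM.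
have t3 := uNZ (p.[0])%:C (1 : U); rewrite rnorm_real in t3.
have t4 := @uN1 R A; have t5 := @uN_ge0 R A 1.
by move: p0 (normr_ge0 p.[0]); nra.
Qed.

(* [calc f x]: [x] is [f(h)], for [f] a uniform limit of polynomials on [-1, 1]. *)
Definition calc (f : R -> R) (x : U) : Prop := forall e, 0 < e ->
  exists2 p, forall s, `|s| <= 1 -> `|f s - p.[s]| <= e & uB (x - pcalc p) <= e.

Lemma calc_pcalc p : calc (fun s => p.[s]) (pcalc p).
Proof.
by move=> e e0; exists p => [s _|]; rewrite subrr ?normr0 /uB ?rnorm0 ?addr0 ltW.
Qed.

Lemma calc_ext f g x : (forall s, `|s| <= 1 -> f s = g s) -> calc f x -> calc g x.
Proof.
by move=> fg fx e /fx[p fp xp]; exists p => // s s1; rewrite -fg // fp.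
Qed.

Lemma calc_uniq f x y : calc f x -> calc f y -> x = y.
Proof.
move=> fx fy; apply: uB_eps_eq => e e0.
have [|p fp xp] := fx (e / 8); first by rewrite divr_gt0.
have [|q fq yq] := fy (e / 8); first by rewrite divr_gt0.
have pq s : `|s| <= 1 -> `|(p - q).[s]| <= e / 4.
  move=> s1; have := fp s s1; have := fq s s1; rewrite !hornerE.
  by rewrite ler_norml => /andP[a1 a2]; rewrite !ler_norml => /andP[b1 b2]; lra.
have := pcalc_uB pq; rewrite pcalcB => d.
apply: (le_trans (uB_triangle (pcalc p) _ _)).
have := uB_triangle (pcalc q) (pcalc p) y; rewrite uB_distC in yq.
by move: xp; lra.
Qed.

Lemma calc_exists f : poly_approx f -> exists x, calc f x.
Proof.
move=> fa.
have /choice[p fp] n : exists p, forall s, `|s| <= 1 -> `|f s - p.[s]| <= 2^-1 ^+ n.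
  by apply: fa; rewrite exprn_gt0 // invr_gt0.
have [e e0|e e0|x _ xp] := @uB_limit R A (f 0)%:C (fun n => pcalc (p n)).
- have [N hN] := half_expn_small 1 e0; exists N => n /hN; rewrite mul1r => hn.
  by apply: le_trans hn; rewrite pcalc1 -rmorphB rnorm_real distrC fp ?normr0 ?ler01.
- have [N hN] := half_expn_small 6 e0; exists N => m n Nm Nn.
  rewrite -pcalcB; apply: (@le_trans _ _ (3 * (e / 3))); last lra.
  apply: pcalc_uB => s s1; rewrite !hornerE.
  have := hN _ Nm; have := hN _ Nn; have := fp n s s1; have := fp m s s1.
  by rewrite !ler_norml => /andP[a1 a2] /andP[b1 b2]; lra.
exists x => e e0; have [N1 h1] := half_expn_small 1 e0; have [N2 h2'] := xp e e0.
exists (p (maxn N1 N2)) => [s s1|].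
  by apply: (le_trans (fp _ s s1)); rewrite -[leLHS]mul1r h1 // leq_maxl.
by rewrite uB_distC h2' // leq_maxr.
Qed.

Lemma calc_bounded f x : calc f x ->
  exists2 M, 0 < M & forall s, `|s| <= 1 -> `|f s| <= M.
Proof.
move=> /(_ 1 ltr01)[p fp _]; exists (1 + \sum_(i < size p) `|p`_i|).
  by rewrite ltr_pwDl // sumr_ge0.
move=> s s1; rewrite -[f s](subrK p.[s]) (le_trans (ler_normD _ _)) // lerD ?fp //.
rewrite horner_coef (le_trans (ler_norm_sum _ _ _)) // ler_sum // => i _.
by rewrite normrM normrX ler_piMr // exprn_ile1.
Qed.

Lemma calcD f g x y : calc f x -> calc g y -> calc (fun s => f s + g s) (x + y).
Proof.
move=> fx gy e e0; have e20 : 0 < e / 2 by rewrite divr_gt0.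
have [p fp xp] := fx _ e20; have [q gq yq] := gy _ e20; exists (p + q) => [s s1|].
  rewrite !hornerE opprD addrACA (le_trans (ler_normD _ _)) //.
  by have := fp s s1; have := gq s s1; lra.
rewrite pcalcD opprD addrACA (le_trans (uBD _ _)) //.
by move: xp yq; lra.
Qed.

Lemma calcZ (c : R) f x : calc f x -> calc (fun s => c * f s) (c%:C *: x).
Proof.
move=> fx e e0; have c0 : 0 < `|c| + 1 by rewrite ltr_wpDl.
have [|p fp xp] := fx (e / (`|c| + 1)); first by rewrite divr_gt0.
have ce : `|c| * (e / (`|c| + 1)) <= e.
  by rewrite mulrA ler_pdivrMr // mulrC ler_pM2l // lerDl.
exists (c *: p) => [s s1|].
  by rewrite hornerZ -mulrBr normrM (le_trans _ ce) // ler_wpM2l // fp.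
rewrite -mul_polyC pcalcM pcalcC -scalerAl mul1r -scalerBr uBZ rnorm_real.
by rewrite (le_trans _ ce) // ler_wpM2l.
Qed.

Lemma calcM f g x y : calc f x -> calc g y -> calc (fun s => f s * g s) (x * y).
Proof.
move=> fx gy e e0.
have [M M0 fM] := calc_bounded fx.
have [L L0 gL] := calc_bounded gy.
(* One constant for two errors: with d <= 1, the error on f g is at most d (M + L + 1) and the error
   on x y at most d (|x| + |y| + 1). *)
pose K := M + L + uB x + uB y + 1.
have [x0 y0] := (uB_ge0 x, uB_ge0 y).
have K0 : 0 < K by rewrite /K; lra.
pose d := Num.min 1 (e / K).
have d0 : 0 < d by rewrite lt_min ltr01 divr_gt0.
have d1 : d <= 1 by rewrite ge_min lexx.
have dK : d * K <= e by rewrite -ler_pdivlMr // ge_min lexx orbT.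
have [p fp xp] := fx _ d0; have [q gq yq] := gy _ d0; exists (p * q) => [s s1|].
  rewrite hornerM.
  have -> : f s * g s - p.[s] * q.[s] =
    f s * (g s - q.[s]) + (f s - p.[s]) * (g s - (g s - q.[s])) by ring.
  have a1 := fp s s1; have a2 := gq s s1; have a3 := fM s s1; have a4 := gL s s1.
  apply: (le_trans (ler_normD _ _)); rewrite !normrM.
  have a5 := ler_normB (g s) (g s - q.[s]).
  move: a1 a2 a3 a4 a5 (normr_ge0 (f s)) (normr_ge0 (f s - p.[s])).
  move: (normr_ge0 (g s - q.[s])) (normr_ge0 (g s - (g s - q.[s]))).
  move: `|f s| `|g s| `|f s - _| `|g s - q.[s]| `|g s - (_ - _)| => F G F' G' G'' *.
  have k1 : F * G' <= M * d by apply: ler_pM.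
  have k2 : F' * G'' <= d * (L + 1) by apply: ler_pM => //; lra.
  by apply: le_trans dK; rewrite /K; nra.
rewrite pcalcM.
have -> : x * y - pcalc p * pcalc q =
    x * (y - pcalc q) + (x - pcalc p) * (y - (y - pcalc q)).
  by rewrite subKr mulrBr mulrBl addrA subrK.
apply: (le_trans (uBD _ _)).
have b1 := uBM x (y - pcalc q).
have b2 := uBM (x - pcalc p) (y - (y - pcalc q)).
have b3 := uBB y (y - pcalc q).
move: xp yq b1 b2 b3 (uB_ge0 (x - pcalc p)) (uB_ge0 (y - pcalc q)) x0.
move: (uB_ge0 (y - (y - pcalc q))).
move: (uB (x - _)) (uB (y - (y - _))) (uB (y - pcalc q)) => F' G'' G' *.
have k1 : uB x * G' <= uB x * d by apply: ler_pM.
have k2 : F' * G'' <= d * (uB y + 1) by apply: ler_pM => //; lra.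
by apply: le_trans dK; rewrite /K; nra.
Qed.

Lemma calc_cst (c : R) : calc (fun=> c) (c%:C *: 1).
Proof.
rewrite -pcalcC; apply: calc_ext (calc_pcalc c%:P) => s _.
by rewrite hornerC.
Qed.

Lemma calc1 : calc (fun=> 1) 1.
Proof. by have := calc_cst 1; rewrite rmorph1 scale1r. Qed.

Lemma calc0 : calc (fun=> 0) 0.
Proof. by have := calc_cst 0; rewrite rmorph0 scale0r. Qed.

Lemma calc_id : calc id H.
Proof.
by rewrite -pcalc_X; apply: calc_ext (calc_pcalc 'X) => s _; rewrite hornerX.
Qed.

Lemma calcB f g x y : calc f x -> calc g y -> calc (fun s => f s - g s) (x - y).
Proof.
move=> fx gy; have := calcD fx (calcZ (-1) gy); rewrite rmorphN1 scaleN1r.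
by apply: calc_ext => s _; rewrite mulN1r.
Qed.

Lemma calc_sum (I : Type) (s : seq I) (P : pred I) (f : I -> R -> R) (x : I -> U) :
  (forall i, calc (f i) (x i)) ->
  calc (fun t => \sum_(i <- s | P i) f i t) (\sum_(i <- s | P i) x i).
Proof.
move=> fx; elim: s => [|i s IH].
  by rewrite big_nil; apply: calc_ext calc0 => t _; rewrite big_nil.
rewrite big_cons; case: ifP => Pi.
  by apply: calc_ext (calcD (fx i) IH) => t _; rewrite big_cons Pi.
by apply: calc_ext IH => t _; rewrite big_cons Pi.
Qed.

Lemma calc_star f x : calc f x -> ustar x = x.
Proof.
move=> fx; apply: uB_eps_eq => e e0.
have [|p fp xp] := fx (e / 2); first by rewrite divr_gt0.
apply: (le_trans (uB_triangle (pcalc p) _ _)).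
by rewrite -{1}pcalc_star -ustarB uB_star uB_distC [uB (pcalc p - x)]uB_distC; lra.
Qed.

Lemma calc_norm f x M : calc f x -> (forall s, `|s| <= 1 -> `|f s| <= M) -> uN x <= M.
Proof.
move=> fx fM; apply/ler_addgt0Pl => e e0.
have [|p fp xp] := fx (e / 2); first by rewrite divr_gt0.
have pM s : `|s| <= 1 -> `|p.[s]| <= e / 2 + M.
  move=> s1; rewrite -[p.[s]](subKr (f s)) (le_trans (ler_normB _ _)) //.
  by rewrite addrC lerD ?fp ?fM.
rewrite -[x](subrK (pcalc p)) (le_trans (uND _ _)) //.
have := uN_uB (x - pcalc p); have := pcalc_bound pM; lra.
Qed.

Lemma calc_scalar f x : calc f x -> x.1 = (f 0)%:C.
Proof.
move=> fx; apply: rnorm_eps_eq => e e0.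
have [|p fp xp] := fx (e / 2); first by rewrite divr_gt0.
apply: (le_trans (rnorm_triangle (pcalc p).1 _ _)).
have : rnorm (x.1 - (pcalc p).1) <= e / 2.
  by apply: le_trans xp; rewrite /uB lerDl rnorm_ge0.
have := fp 0; rewrite normr0 => /(_ ler01).
by rewrite pcalc1 -rmorphB rnorm_real distrC; lra.
Qed.

End PolynomialCalculus.

(** * Factorization and approximate units *)

Section Factorization.
Variables (R : realType) (A : cstarAlgType R).
Local Notation U := (unitz A).
Implicit Types (a b h : A).

Lemma small_scaling a : exists2 t : R, 0 < t & rnorm (t%:C *: a) <= 2^-1.
Proof.
exists (2 * (rnorm a + 1))^-1; have a0 := rnorm_ge0 a.
  by rewrite invr_gt0 mulr_gt0 // ltr_wpDl.
rewrite rnormZ rnorm_real ger0_norm ?invr_ge0 ?mulr_ge0 ?addr_ge0 //.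
rewrite mulrC ler_pdivrMr; last by rewrite mulr_gt0 // ltr_wpDl.
by rewrite mulrA mulVf ?mul1r ?lerDl.
Qed.

Definition sum_of_products a : Prop :=
  exists s : seq (A * A), a = \sum_(p <- s) p.1 ** p.2.

Lemma sum_of_productsD a b :
  sum_of_products a -> sum_of_products b -> sum_of_products (a + b).
Proof. by move=> [s ->] [r ->]; exists (s ++ r); rewrite big_cat. Qed.

Lemma sum_of_productsZ k a : sum_of_products a -> sum_of_products (k *: a).
Proof.
move=> [s ->]; exists [seq (k *: p.1, p.2) | p <- s].
by rewrite big_map scaler_sumr; apply: eq_bigr => p _ /=; rewrite cmulZl.
Qed.

(** Cartesian decomposition and scaling: whatever is stable under linear combinations need only be
    checked on the elements that admit the functional calculus. *)
Lemma selfadjoint_span (P : A -> Prop) :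
  (forall a b, P a -> P b -> P (a + b)) -> (forall k a, P a -> P (k *: a)) ->
  (forall h, cstar h = h -> rnorm h <= 2^-1 -> P h) -> forall a, P a.
Proof.
move=> PD PZ Psmall a.
have Psa h : cstar h = h -> P h.
  move=> hS; have [t t0 ht] := small_scaling h.
  have -> : h = (t^-1)%:C *: (t%:C *: h).
    by rewrite scalerA -real_complexM mulVf ?lt0r_neq0 // scale1r.
  apply/PZ/Psmall => //; rewrite cstarZ hS; congr (_ *: _).
  by apply/CrealP/complex_realP; exists t.
pose j : R[i] := 'i; have jj : j * j = -1 by rewrite -expr2 sqrCi.
have jS : j^* = - j by rewrite conjCi.
have -> : a = (2^-1 : R[i]) *: (a + cstar a) + (2^-1 * j) *: (- j *: (a - cstar a)).
  rewrite scalerA -mulrA mulrN jj opprK mulr1 -scalerDr addrACA subrr addr0.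
  by rewrite scalerDr -scalerDl (_ : 2^-1 + 2^-1 = 1 :> R[i]) ?scale1r //; field.
apply: PD; apply: PZ; apply: Psa; first by rewrite cstarD cstarK addrC.
by rewrite cstarZ cstarB cstarK -jS conjCK -[cstar a - a]opprB scalerN jS scaleNr.
Qed.

(** s = sqrt(s)^2 - sqrt(-s)^2, because [Num.sqrt] vanishes on negative reals. Both roots vanish at
    0, so applied to h they have no scalar part and lie in [A] itself. *)
Lemma factorization a : sum_of_products a.
Proof.
move: a; apply: (selfadjoint_span sum_of_productsD sum_of_productsZ) => h hS h2.
have [x xs] := calc_exists hS h2 (@sqrt_poly_approx R).
have [y ys] := calc_exists hS h2 (poly_approx_opp (@sqrt_poly_approx R)).
have x1 : x = uemb x.2.
  by apply: unitz_eq => //=; rewrite (calc_scalar xs) sqrtr0.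
have y1 : y = uemb y.2.
  by apply: unitz_eq => //=; rewrite (calc_scalar ys) oppr0 sqrtr0.
have E : uemb h = x * x - y * y.
  apply: (calc_uniq hS h2 (@calc_id R A h)).
  apply: calc_ext (calcB (calcM xs xs) (calcM ys ys)) => s _.
  rewrite -!expr2; have [s0|s0] := leP 0 s.
    by rewrite sqr_sqrtr // (ler0_sqrtr (a := - s)) ?oppr_le0 // expr0n subr0.
  by rewrite (ltr0_sqrtr s0) expr0n sqr_sqrtr ?oppr_ge0 ?ltW // sub0r opprK.
have -> : h = x.2 ** x.2 - y.2 ** y.2.
  by have := congr1 snd E; rewrite x1 y1 /= !scale0r !add0r.
exists [:: (x.2, x.2); (- y.2, y.2)].
by rewrite !big_cons big_nil /= cmulNl addr0.
Qed.

End Factorization.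

(** * Approximate units *)

Section ApproximateUnits.
Variables (R : realType) (A : cstarAlgType R).
Local Notation U := (unitz A).
Implicit Types (a b y : A) (d x : U) (f : dual A) (e : R).

(* [d = 1 - u] with [u] in [A]: the approximate unit is made of such [u]. *)
Definition contractive_defect d : Prop := d.1 = 1 /\ uN d <= 1.

Lemma contractive_defect1 : contractive_defect 1.
Proof. by split=> //; exact: uN1. Qed.

Lemma contractive_defectM d d' :
  contractive_defect d -> contractive_defect d' -> contractive_defect (d * d').
Proof.
move=> [d1 dn] [d1' dn']; split; first by rewrite umul1E d1 d1' mulr1.
by rewrite (le_trans (uNM _ _)) // mulr_ile1 ?uN_ge0.
Qed.

(** With h = t a a* and x = f(h), self-adjoint of seminorm at most 1, one has t |x a|^2 = |x h x| <=
    |x h|, and x h is the value at h of the function f(s) s. *)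
Lemma calc_lact_small a (t eta : R) (f : R -> R) (x : U) : 0 < t ->
  rnorm (t%:C *: (a ** cstar a)) <= 2^-1 ->
  calc (t%:C *: (a ** cstar a)) f x ->
  (forall s, `|s| <= 1 -> `|f s| <= 1) ->
  (forall s, `|s| <= 1 -> `|f s * s| <= eta) ->
  rnorm (lact x a) ^+ 2 * t <= eta.
Proof.
move=> t0; set h := t%:C *: _ => h2 fx f1 fe.
have hS : cstar h = h.
  rewrite cstarZ cstarM cstarK; congr (_ *: _).
  by apply/CrealP/complex_realP; exists t.
have xS := calc_star hS fx.
have xn := calc_norm hS h2 fx f1.
have le1 : rnorm (lact x h) <= eta.
  rewrite -uN_emb uemb_lact.
  exact: (calc_norm hS h2 (calcM fx (@calc_id R A h)) fe).
rewrite -crnorm_mul_star cstar_lact xS cmul_ract -lact_cmul.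
have tE b : rnorm (t%:C *: b) = rnorm b * t.
  by rewrite rnormZ rnorm_real ger0_norm ?(ltW t0) // mulrC.
rewrite /h lactZr tE in le1; apply: le_trans le1; rewrite ler_pM2r //.
by rewrite (le_trans (uN_ract _ _)) // -[leRHS]mul1r ler_wpM2r ?rnorm_ge0.
Qed.

Let max0 (s : R) : R := Num.max 0 s.

Let max0_ge s : s <= max0 s. Proof. by rewrite le_max lexx orbT. Qed.
Let max0_ge0 s : 0 <= max0 s. Proof. by rewrite le_max lexx. Qed.
Let max0_le0 s : s <= 0 -> max0 s = 0. Proof. by move=> h; rewrite /max0 max_l. Qed.
Let max0_id s : 0 <= s -> max0 s = s. Proof. by move=> h; rewrite /max0 max_r. Qed.

Lemma approx_split a e : 0 < e -> exists d x : U,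
  [/\ contractive_defect d, uN x <= 1, ustar x * d = 0,
      rnorm (lact d a) <= e & rnorm (a - lact x a) <= e].
Proof.
move=> e0; have [t t0 h2] := small_scaling (a ** cstar a).
set h := t%:C *: _ in h2.
have hS : cstar h = h.
  rewrite cstarZ cstarM cstarK; congr (_ *: _).
  by apply/CrealP/complex_realP; exists t.
(* Chosen so that |f(s) s| <= 2r turns into t |f(h) a|^2 <= t e^2. *)
pose r := e ^+ 2 * t / 2.
have r0 : 0 < r by rewrite divr_gt0 // mulr_gt0 // exprn_gt0.
(* [bump] lives on |s| <= r; [plateau] vanishes there and is 1 from 2r on. Hence x d = 0, the scalar
   part of d is the value 1 of [bump] at 0, and both [bump] and 1 - [plateau] satisfy f(s) |s| <=
   2r. *)
pose bump (s : R) := max0 (1 - `|s| / r).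
pose plateau (s : R) := max0 (1 - max0 (2 - `|s| / r)).
have lip (c : R) : poly_approx (fun s : R => max0 (c - `|s| / r)).
  apply: (@lipschitz_poly_approx _ _ r^-1) => s u.
  apply: (le_trans (max0_lipschitz _ _)).
  rewrite opprD addrACA subrr add0r opprK addrC -mulrBl normrM.
  rewrite (ger0_norm (_ : 0 <= r^-1)) ?invr_ge0 ?(ltW r0) // mulrC.
  by rewrite ler_wpM2l ?invr_ge0 ?(ltW r0) // distrC ler_dist_dist.
have lip2 : poly_approx plateau.
  apply: (@lipschitz_poly_approx _ _ r^-1) => s u.
  apply: (le_trans (max0_lipschitz _ _)).
  rewrite opprD addrACA subrr add0r opprK addrC.
  apply: (le_trans (max0_lipschitz _ _)).
  rewrite opprD addrACA subrr add0r opprK addrC -mulrBl normrM.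
  rewrite (ger0_norm (_ : 0 <= r^-1)) ?invr_ge0 ?(ltW r0) // mulrC.
  by rewrite ler_wpM2l ?invr_ge0 ?(ltW r0) // ler_dist_dist.
have [d cd] := calc_exists hS h2 (lip 1).
have [x cx] := calc_exists hS h2 lip2.
have rr (s : R) : `|s| = `|s| / r * r by rewrite divfK // lt0r_neq0.
have q0 (s : R) : 0 <= `|s| / r by rewrite divr_ge0 // ltW.
have bump1 s : 0 <= bump s <= 1.
  rewrite max0_ge0 /= /bump; have := q0 s.
  have [h1|h1] := leP (1 - `|s| / r) 0; first by rewrite (max0_le0 h1).
  by rewrite (max0_id (ltW h1)); lra.
have plateau1 s : 0 <= plateau s <= 1.
  rewrite max0_ge0 /= /plateau; have := max0_ge0 (2 - `|s| / r).
  have [h1|h1] := leP (1 - max0 (2 - `|s| / r)) 0; first by rewrite (max0_le0 h1).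
  by rewrite (max0_id (ltW h1)); lra.
have small (f : R -> R) (z : U) : calc h f z -> (forall s, 0 <= f s <= 1) ->
    (forall s, f s * (`|s| / r) <= 2) -> rnorm (lact z a) <= e.
  move=> fz f1 f2; rewrite -(@ler_sqr _ _ e) ?nnegrE ?rnorm_ge0 ?(ltW e0) //.
  rewrite -(ler_pM2r t0) (_ : e ^+ 2 * t = 2 * r); last by rewrite /r; field.
  apply: (calc_lact_small t0 h2 fz) => s s1.
    by have := f1 s; rewrite ler_norml; lra.
  rewrite normrM (rr s) mulrA ler_wpM2r ?(ltW r0) //.
  by have /andP[f0 _] := f1 s; rewrite ger0_norm.
exists d, x; split.
- split; first by rewrite (calc_scalar cd) normr0 mul0r subr0 max0_id ?ler01.
  apply: (calc_norm hS h2 cd) => s _.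
  by have := bump1 s; rewrite /bump ler_norml; lra.
- apply: (calc_norm hS h2 cx) => s _.
  by have := plateau1 s; rewrite ler_norml; lra.
- rewrite (calc_star hS cx); apply: (calc_uniq hS h2 (calcM cx cd)).
  apply: calc_ext (@calc0 R A h) => s _; rewrite /plateau.
  have [h1|h1] := leP (`|s| / r) 1.
    rewrite (max0_le0 (s := 1 - _)) ?mul0r //.
    by have := max0_ge (2 - `|s| / r); lra.
  by rewrite (max0_le0 (s := 1 - `|s| / r)) ?mulr0 //; lra.
- apply: (small _ _ cd) => // s.
  have := q0 s; have [h1|h1] := leP (1 - `|s| / r) 0.
    by rewrite (max0_le0 h1) mul0r.
  rewrite (max0_id (ltW h1)); move: (`|s| / r) h1 => u *; nra.
- have -> : a - lact x a = lact (1 - x) a.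
    by rewrite lactD lact1 -[- x]scaleN1r lactZ scaleN1r.
  apply: (small _ _ (calcB (@calc1 R A h) cx)) => s.
    by have := plateau1 s; lra.
  have [h1|h1] := leP (2 - `|s| / r) 0.
    by rewrite /plateau (max0_le0 h1) subr0 max0_id // subrr mul0r.
  have := q0 s; have := plateau1 s.
  by move: (plateau s) (`|s| / r) h1 => u v *; nra.
Qed.

End ApproximateUnits.

Section ApproximateUnitFunctionals.
Variables (R : realType) (A : cstarAlgType R).
Local Notation U := (unitz A).
Implicit Types (a b y : A) (d x : U) (f : dual A) (e : R).

Lemma right_defect a e : 0 < e ->
  exists2 d, contractive_defect d & rnorm (ract a d) <= e.
Proof.
move=> e0; have [d [_ [[d1 dn] _ _ da _]]] := approx_split (cstar a) e0.
exists (ustar d); first by split; rewrite ?uN_star //= d1 conjC1.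
by rewrite ractE ustarK crnorm_star.
Qed.

Lemma almost_norming f e : 0 < e -> exists x : A, rnorm x <= 1 /\
  exists2 c : R, rnorm f - e <= c & f x = c%:C.
Proof.
(* When |f| <= e the vector 0 is enough. Otherwise [rnorm f - e] is positive, as it must be to serve
   as an operator bound for the contradiction. *)
move=> e0; have [fe|ef] := leP (rnorm f) e.
  exists 0; rewrite rnorm0; split=> //; exists 0; first by lra.
  by rewrite linear0.
apply: contrapT => nox.
have bd y : rnorm (f y) <= (rnorm f - e) * rnorm y.
  have [y0|y0] := eqVneq (rnorm y) 0.
    by rewrite (rnorm0_eq0 y0) linear0 !rnorm0 mulr0.
  have yp : 0 < rnorm y by rewrite lt0r y0 rnorm_ge0.
  rewrite leNgt; apply/negP => lt; apply: nox.
  have [w w1 wE] := rnorm_rotate (f y).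
  exists ((rnorm y)^-1%:C *: (w *: y)); split.
    by rewrite !rnormZ w1 mul1r rnorm_real ger0_norm ?invr_ge0 ?rnorm_ge0 // mulVf.
  exists ((rnorm y)^-1 * rnorm (f y)); last first.
    rewrite !linearZ -[LHS]/((rnorm y)^-1%:C * (w * f y)).
  by rewrite wE -real_complexM.
  by rewrite mulrC ler_pdivlMr // ltW.
have := blin_rnorm_ub _ bd; rewrite subr_ge0 => /(_ (ltW ef)); lra.
Qed.

Lemma functional_defect f e : 0 < e -> exists2 d, contractive_defect d &
  forall y, rnorm (f (lact d y)) <= e * rnorm y.
Proof.
move=> e0; pose n := rnorm f; have n0 : 0 <= n by exact: rnorm_ge0.
(* With all tolerances t^2, the real part of f(z) is at least n - t^2 - n t^2 + t |f(d y)|, while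
   |f(z)| <= n (1 + t^2). The difference is t |f(d y)| <= (2n + 1) t^2 = t e. *)
pose t := e / (2 * n + 1).
have t0 : 0 < t by rewrite divr_gt0 // ltr_wpDl // mulr_ge0.
have tE : (2 * n + 1) * t = e by rewrite mulrC divfK // lt0r_neq0 // ltr_wpDl // mulr_ge0.
have t20 : 0 < t ^+ 2 by rewrite exprn_gt0.
have [a [a1 [c nc fa]]] := almost_norming f t20.
have [d [x [dd xn xd _ ax]]] := approx_split a t20.
exists d => //.
suff unit_ball y : rnorm y <= 1 -> rnorm (f (lact d y)) <= e.
  move=> y; have [y0|y0] := eqVneq (rnorm y) 0.
    by rewrite (rnorm0_eq0 y0) lact0r linear0 !rnorm0 mulr0.
  have yp : 0 < rnorm y by rewrite lt0r y0 rnorm_ge0.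
  have := unit_ball ((rnorm y)^-1%:C *: y); rewrite lactZr linearZ /=.
  rewrite [rnorm (_ *: f _)]rnormM rnormZ rnorm_real.
  rewrite ger0_norm ?invr_ge0 ?rnorm_ge0 // mulVf //.
  by rewrite -ler_pdivrMr // mulrC; apply.
move=> y1; have [w w1 wE] := rnorm_rotate (f (lact d y)).
pose z := lact x a + t%:C *: lact d (w *: y).
have z2 : rnorm z ^+ 2 <= 1 + t ^+ 2.
  have cross : cstar (lact x a) ** (t%:C *: lact d (w *: y)) = 0.
    rewrite cmulZr.
    by rewrite cstar_lact ract_lact -lactM xd /lact /= scale0r cmul0l addr0 cmul0r scaler0.
  apply: (le_trans (rnorm_orthogonal cross)).
  rewrite rnormZ rnorm_real (ger0_norm (ltW t0)) exprMn lerD //.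
    by rewrite expr_le1 ?rnorm_ge0 // (le_trans (uN_le _ _)) // mulr_ile1 ?uN_ge0 ?rnorm_ge0.
  rewrite -[leRHS]mulr1 ler_wpM2l ?(ltW t20) // expr_le1 ?rnorm_ge0 //.
  have [_ dn] := dd.
  by rewrite (le_trans (uN_le _ _)) // mulr_ile1 ?uN_ge0 ?rnorm_ge0 // rnormZ w1 mul1r.
have z1 : rnorm z <= 1 + t ^+ 2.
  by rewrite -(@ler_sqr _ _ (1 + _)) ?nnegrE ?rnorm_ge0 //; [nra | lra].
have fl : f (lact x a) = c%:C - f (a - lact x a).
  by have := blin_sub f a (a - lact x a); rewrite subKr fa.
have fw : f (t%:C *: lact d (w *: y)) = (t * rnorm (f (lact d y)))%:C.
  rewrite lactZr !linearZ -[LHS]/(t%:C * (w * f (lact d y))).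
  by rewrite wE -real_complexM.
have ReD (u v : R[i]) : complex.Re (u + v) = complex.Re u + complex.Re v.
  by case: u v => [? ?] [].
have ReN (u : R[i]) : complex.Re (- u) = - complex.Re u by case: u.
have Rz : complex.Re (f z) = c - complex.Re (f (a - lact x a)) + t * rnorm (f (lact d y)).
  by rewrite /z blin_add fl fw !ReD ReN.
have b1 := blin_rnorm_le f z; have b2 := blin_rnorm_le f (a - lact x a).
have b3 := rnormc_Re (f z); have b4 := rnormc_Re (f (a - lact x a)).
rewrite -/n in b1 b2 nc; rewrite Rz in b3.
have {}b1 : rnorm (f z) <= n * (1 + t ^+ 2) by rewrite (le_trans b1) // ler_wpM2l.
have {}b2 : rnorm (f (a - lact x a)) <= n * t ^+ 2 by rewrite (le_trans b2) // ler_wpM2l.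
have {}b3 := le_trans (ler_norm _) (le_trans b3 b1).
have {}b4 := le_trans (ler_norm _) (le_trans b4 b2).
rewrite -(ler_pM2l t0) -tE (_ : t * (_ * t) = (2 * n + 1) * t ^+ 2); last by ring.
by move: b3 b4 nc; lra.
Qed.

Implicit Types (L : seq (A * dual A)).

(** The pairs (L, e) play the part of a filter base of the approximate unit. The bound on the
    functionals is uniform in y because norm convergence of f((1 - u) y) in the dual is needed
    later. *)
Definition approximates L e d : Prop := forall p, p \in L ->
  rnorm (ract p.1 d) <= e /\ forall y, rnorm (p.2 (lact d y)) <= e * rnorm y.

(** Multiplying d on the right by contractions preserves the estimates already obtained. The order
    of choice matters: d1 is chosen for the element a d, and then d2 for the functional that sends y
    to f(d d1 y). *)
Lemma approximates_exists L e : 0 < e ->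
  exists2 d, contractive_defect d & approximates L e d.
Proof.
move=> e0; elim: L => [|[a f] L [d dd dL]].
  by exists 1; first exact: contractive_defect1.
have [d1 dd1 a1] := right_defect (ract a d) e0.
have [d2 dd2 f2] := functional_defect (transpose_dual (lact_op (d * d1)) f) e0.
have dd12 := contractive_defectM dd1 dd2.
have [_ n2] := dd2; have [_ n12] := dd12.
exists (d * (d1 * d2)); first exact: contractive_defectM.
move=> p; rewrite inE => /predU1P[->|pL] /=.
  split=> [|y]; last by have := f2 y; rewrite /= -lactM mulrA.
  by rewrite !ractM (le_trans (uN_ract _ _)) // (le_trans _ a1) // ler_piMl ?rnorm_ge0.
have [q1 q2] := dL p pL; split=> [|y].
  by rewrite ractM (le_trans (uN_ract _ _)) // (le_trans _ q1) // ler_piMl ?rnorm_ge0.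
rewrite lactM (le_trans (q2 _)) // ler_wpM2l ?(ltW e0) //.
by rewrite (le_trans (uN_le _ _)) // ler_piMl ?rnorm_ge0.
Qed.

Lemma approximates_sub L L' e e' d : e <= e' -> {subset L' <= L} ->
  approximates L e d -> approximates L' e' d.
Proof.
move=> ee' LL' dL p /LL' /dL[q1 q2]; split=> [|y]; first exact: le_trans ee'.
by rewrite (le_trans (q2 _)) // ler_wpM2r ?rnorm_ge0.
Qed.

Definition defect_unit d : A := - d.2.

Lemma defect_unit_mul d b : contractive_defect d -> defect_unit d ** b = b - lact d b.
Proof.
by move=> [d1 _]; rewrite /lact d1 scale1r opprD addNKr cmulNl.
Qed.

Lemma mul_defect_unit d b : contractive_defect d -> b ** defect_unit d = b - ract b d.
Proof.
by move=> [d1 _]; rewrite /ract d1 scale1r opprD addNKr cmulNr.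
Qed.

Lemma rnorm_defect_unit d : contractive_defect d -> rnorm (defect_unit d) <= 2.
Proof.
move=> [d1 dn]; rewrite -uN_emb.
have -> : uemb (defect_unit d) = 1 - d.
  by apply: unitz_eq; rewrite /= ?d1 ?subrr ?sub0r.
by apply: (le_trans (uNB _ _)); have := @uN1 R A; move: dn; lra.
Qed.

(* [z] is the limit of [f] along the approximate unit. *)
Definition unit_limit f (z : R[i]) : Prop := forall e, 0 < e ->
  exists L, exists2 r : R, 0 < r & forall d, contractive_defect d ->
    approximates L r d -> rnorm (f (defect_unit d) - z) <= e.

Lemma unit_limit_common f g z w e : unit_limit f z -> unit_limit g w -> 0 < e ->
  exists d, [/\ contractive_defect d, rnorm (f (defect_unit d) - z) <= e &
    rnorm (g (defect_unit d) - w) <= e].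
Proof.
move=> fz gw e0; have [L [r r0 hL]] := fz e e0; have [L' [r' r0' hL']] := gw e e0.
have m0 : 0 < Num.min r r' by rewrite lt_min r0.
have [d dd dL] := approximates_exists (L ++ L') m0.
exists d; split=> //; [apply: hL => // | apply: hL' => //];
  apply: approximates_sub dL => [|p pL]; rewrite ?ge_min ?lexx ?orbT // mem_cat pL ?orbT //.
Qed.

Lemma unit_limit_uniq f z w : unit_limit f z -> unit_limit f w -> z = w.
Proof.
move=> fz fw; apply: rnorm_eps_eq => e e0.
have e20 : 0 < e / 2 by rewrite divr_gt0.
have [d [_ h1 h2]] := unit_limit_common fz fw e20.
have := rnorm_triangle (f (defect_unit d) : R[i]) z w.
rewrite (rnorm_distC z (f _)) => /le_trans; apply.
by rewrite [leRHS](splitr e) lerD.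
Qed.

Lemma unit_limit_linear f g z w (k : R[i]) :
  unit_limit f z -> unit_limit g w -> unit_limit (k *: f + g) (k * z + w).
Proof.
move=> fz gw e e0; have k0 := rnorm_ge0 k.
have r0 : 0 < e / (rnorm k + 1) by rewrite divr_gt0 // ltr_wpDl.
have rE : e = (rnorm k + 1) * (e / (rnorm k + 1)).
  by rewrite mulrC divfK // lt0r_neq0 // ltr_wpDl.
have [L [r1 r10 hL]] := fz _ r0; have [L' [r2 r20 hL']] := gw _ r0.
exists (L ++ L'), (Num.min r1 r2); first by rewrite lt_min r10.
move=> d dd dL.
have {hL}h1 := hL d dd; have {hL'}h2 := hL' d dd.
have {}h1 : rnorm (f (defect_unit d) - z) <= e / (rnorm k + 1).
  apply: h1; apply: approximates_sub dL => [|p pL]; first by rewrite ge_min lexx.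
  by rewrite mem_cat pL.
have {}h2 : rnorm (g (defect_unit d) - w) <= e / (rnorm k + 1).
  apply: h2; apply: approximates_sub dL => [|p pL]; first by rewrite ge_min lexx orbT.
  by rewrite mem_cat pL orbT.
have -> : (k *: f + g) (defect_unit d) - (k * z + w) =
    k * (f (defect_unit d) - z) + (g (defect_unit d) - w) :> R[i].
  by rewrite mulrBr opprD addrACA.
rewrite rE (le_trans (rnormD _ _)) // rnormM mulrDl mul1r lerD //.
by rewrite ler_wpM2l.
Qed.

End ApproximateUnitFunctionals.

(** * The identity of the bidual *)

Section BidualOne.
Variables (R : realType) (A : cstarAlgType R).
Local Notation U := (unitz A).
Implicit Types (a b y : A) (d x : U) (f : dual A) (e : R) (F G : bidual A).

Lemma real_complete (u : nat -> R) :
  (forall e, 0 < e -> exists N, forall m n, (N <= m)%N -> (N <= n)%N ->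
    `|u m - u n| <= e) ->
  exists l, forall e, 0 < e -> exists N, forall n, (N <= n)%N -> `|u n - l| <= e.
Proof.
move=> uc.
have /cauchy_cvgP/cvg_ex[l ul] : cauchy (u @ \oo).
  apply/cauchy_ballP => e e0.
  have [|N uN] := uc (e / 2); first by rewrite divr_gt0.
  exists (u @` [set n | (N <= n)%N], u @` [set n | (N <= n)%N]).
    by split; exists N => // n Nn; exists n.
  move=> [_ _] [[m /= Nm <-] [n /= Nn <-]]; rewrite -ball_normE /=.
  by apply: (@le_lt_trans _ _ (e / 2)); [exact: uN | lra].
exists l => e e0; move/cvgrPdist_le : ul => /(_ e e0)[N _ uN]; exists N => n Nn.
by rewrite distrC uN.
Qed.

Lemma complex_rnorm_complete (u : nat -> R[i]) :
  (forall e, 0 < e -> exists N, forall m n, (N <= m)%N -> (N <= n)%N ->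
    rnorm (u m - u n) <= e) ->
  exists l, forall e, 0 < e -> exists N, forall n, (N <= n)%N -> rnorm (u n - l) <= e.
Proof.
move=> uc.
have ReB (x y : R[i]) : complex.Re (x - y) = complex.Re x - complex.Re y.
  by case: x y => [? ?] [].
have ImRe (x : R[i]) : complex.Im x = complex.Re (- 'i%C * x).
  by case: x => a b; simpc; rewrite /=.
have iN : rnorm (- 'i%C : R[i]) = 1.
  by rewrite rnormN /rnorm normc_def /= expr0n expr1n add0r sqrtr1.
have [|a ha] := @real_complete (fun n => complex.Re (u n)).
  move=> e /uc[N hN]; exists N => m n Nm Nn.
  by rewrite -ReB (le_trans (rnormc_Re _)) // hN.
have [|b hb] := @real_complete (fun n => complex.Im (u n)).
  move=> e /uc[N hN]; exists N => m n Nm Nn.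
  rewrite !ImRe -ReB -mulrBr (le_trans (rnormc_Re _)) // rnormM iN mul1r hN //.
exists (a +i* b) => e e0.
have [|N1 h1] := ha (e / 2); first by rewrite divr_gt0.
have [|N2 h2] := hb (e / 2); first by rewrite divr_gt0.
exists (maxn N1 N2) => n; rewrite geq_max => /andP[/h1 {}h1 /h2 {}h2].
have -> : u n - (a +i* b) =
    (complex.Re (u n) - a)%:C + 'i%C * (complex.Im (u n) - b)%:C.
  by case: (u n) => x y; simpc.
have := rnormD (complex.Re (u n) - a)%:C ('i%C * (complex.Im (u n) - b)%:C).
rewrite rnormM -(rnormN 'i%C) iN mul1r !rnorm_real => /le_trans; apply; lra.
Qed.

(** For u = 1 - d and u0 = 1 - d0 one has u - u0 = d0 u - u0 d. The functional is small on d0 u by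
    the choice of d0, with e/4 since |u| <= 2, and small on u0 d by the requirement put on d. *)
Lemma unit_limit_cauchy f e : 0 < e -> exists z : R[i],
  exists L, exists2 r : R, 0 < r & forall d, contractive_defect d ->
    approximates L r d -> rnorm (f (defect_unit d) - z) <= e.
Proof.
move=> e0; have n0 := rnorm_ge0 f.
have e40 : 0 < e / 4 by rewrite divr_gt0.
have [d0 dd0 f0] := functional_defect f e40.
exists (f (defect_unit d0)), [:: (defect_unit d0, f)].
exists (e / 2 / (rnorm f + 1)); first by rewrite !divr_gt0 // ltr_wpDl.
move=> d dd /(_ _ (mem_head _ _))[/= q _].
have -> : f (defect_unit d) - f (defect_unit d0) =
    f (lact d0 (defect_unit d)) - f (ract (defect_unit d0) d) :> R[i].
  have E : defect_unit d - defect_unit d0 =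
     lact d0 (defect_unit d) - ract (defect_unit d0) d.
    have := defect_unit_mul (defect_unit d) dd0.
    rewrite mul_defect_unit // => E.
    rewrite -[in LHS](subrK (lact d0 (defect_unit d)) (defect_unit d)) -E.
    by rewrite [LHS](+%R.[ACl 3*2*(1*4)]) subrr addr0.
  by have := congr1 f E; rewrite !blin_sub.
apply: (le_trans (rnormB _ _)); rewrite [leRHS](splitr e) lerD //.
  apply: (le_trans (f0 _)); have := rnorm_defect_unit dd; nra.
apply: (le_trans (blin_rnorm_le _ _)); apply: (le_trans (ler_wpM2l n0 q)).
have k : (rnorm f + 1) * (e / 2 / (rnorm f + 1)) = e / 2.
  by rewrite mulrC divfK // lt0r_neq0 // ltr_wpDl.
rewrite -[leRHS]k ler_wpM2r ?lerDl // !divr_ge0 ?(ltW e0) //.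
by rewrite addr_ge0.
Qed.

(** The approximate limits for the tolerances 2^-n form a Cauchy sequence, since a single defect can
    meet the requirements of any two of them. *)
Lemma unit_limit_exists f : exists z, unit_limit f z.
Proof.
have e0 n : 0 < 2^-1 ^+ n :> R by rewrite exprn_gt0 // invr_gt0.
have /choice[z zP] n := unit_limit_cauchy f (e0 n).
have zz m n : rnorm (z m - z n) <= 2^-1 ^+ m + 2^-1 ^+ n.
  have [L [r r0 h]] := zP m; have [L' [r' r0' h']] := zP n.
  have m0 : 0 < Num.min r r' by rewrite lt_min r0.
  have [d dd dL] := approximates_exists (L ++ L') m0.
  apply: (le_trans (rnorm_triangle (f (defect_unit d) : R[i]) _ _)).
  rewrite (rnorm_distC (z m)) lerD //.
    apply: h => //; apply: approximates_sub dL => [|p pL]; first by rewrite ge_min lexx.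
    by rewrite mem_cat pL.
  apply: h' => //; apply: approximates_sub dL => [|p pL]; first by rewrite ge_min lexx orbT.
  by rewrite mem_cat pL orbT.
have [e e_gt0|l zl] := complex_rnorm_complete (u := z).
  have [N hN] := half_expn_small 2 e_gt0; exists N => m n Nm Nn.
  by apply: (le_trans (zz m n)); have := hN m Nm; have := hN n Nn; lra.
exists l => e e_gt0; have [N hN] := half_expn_small 2 e_gt0.
have [N' hN'] := zl (e / 2) ltac:(by rewrite divr_gt0).
have [L [r r0 h]] := zP (maxn N N'); exists L, r => // d dd dL.
apply: (le_trans (rnorm_triangle (z (maxn N N')) _ _)).
have := h d dd dL; have := hN' (maxn N N') (leq_maxr _ _).
by have := hN (maxn N N') (leq_maxl _ _); lra.
Qed.

Definition unit_value f : R[i] := xget 0 (unit_limit f).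

Lemma unit_valueP f : unit_limit f (unit_value f).
Proof. exact: (xgetPex 0 (unit_limit_exists f)). Qed.

Lemma unit_value_linear : linear (unit_value : dual A -> (R[i])^o).
Proof.
move=> k f g; apply: (unit_limit_uniq (unit_valueP (k *: f + g))).
exact: unit_limit_linear (unit_valueP f) (unit_valueP g).
Qed.

Lemma unit_value_bounded : bounded_op (unit_value : dual A -> (R[i])^o).
Proof.
exists 2 => f; rewrite !rnormE -real_complexM lecR.
apply/ler_addgt0Pl => e e0.
have [d [dd h _]] := unit_limit_common (unit_valueP f) (unit_valueP f) e0.
have h1 := blin_rnorm_le f (defect_unit d).
have h2 := rnorm_defect_unit dd.
have h3 := rnormB (f (defect_unit d) : R[i]) (f (defect_unit d) - unit_value f).
rewrite subKr in h3; have n0 := rnorm_ge0 f.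
have h4 : rnorm f * rnorm (defect_unit d) <= rnorm f * 2 by rewrite ler_wpM2l.
by move: h h1 h3 h4; rewrite [2 * _]mulrC; lra.
Qed.

Definition unit_functional : bidual A := BLin unit_value_linear unit_value_bounded.

Lemma unit_functional_act f : bidual_act unit_functional f = f.
Proof.
apply: blinP => a; apply: unit_limit_uniq (unit_valueP _) _ => e e0.
have n0 := rnorm_ge0 f.
exists [:: (a, f)], (e / (rnorm f + 1)); first by rewrite divr_gt0 // ltr_wpDl.
move=> d dd /(_ _ (mem_head _ _))[/= q _].
rewrite mul_defect_unit // blin_sub addrAC subrr add0r rnormN.
apply: (le_trans (blin_rnorm_le _ _)); apply: (le_trans (ler_wpM2l n0 q)).
have k : (rnorm f + 1) * (e / (rnorm f + 1)) = e.
  by rewrite mulrC divfK // lt0r_neq0 // ltr_wpDl.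
by rewrite -[leRHS]k ler_wpM2r ?lerDl // divr_ge0 ?(ltW e0) // addr_ge0.
Qed.

(** The two sides use the two halves of [approximates]. F e = F holds because f(a u) tends to f(a).
    For e F = F the value at f is the limit of F(f.u), so f.u must tend to f in norm. *)
Lemma unit_functional_one : is_bidual_one unit_functional.
Proof.
move=> F; split; apply: blinP => f /=; last by rewrite unit_functional_act.
apply: unit_limit_uniq (unit_valueP _) _ => e e0.
have n0 := rnorm_ge0 F.
have r0 : 0 < e / (rnorm F + 1) by rewrite divr_gt0 // ltr_wpDl.
exists [:: (0, f)], (e / (rnorm F + 1)) => // d dd /(_ _ (mem_head _ _))[/= _ q].
have k : (rnorm F + 1) * (e / (rnorm F + 1)) = e.
  by rewrite mulrC divfK // lt0r_neq0 // ltr_wpDl.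
have -> : F (dual_act f (defect_unit d)) - F f = F (dual_act f (defect_unit d) - f).
  by rewrite blin_sub.
apply: (le_trans (blin_rnorm_le _ _)).
apply: (@le_trans _ _ (rnorm F * (e / (rnorm F + 1)))).
  rewrite ler_wpM2l //; apply: blin_rnorm_ub => [|y]; first exact: ltW.
  have -> : (dual_act f (defect_unit d) - f) y = - f (lact d y).
    rewrite -[LHS]/(f (defect_unit d ** y) + -1 * f y).
    by rewrite defect_unit_mul // blin_sub mulN1r addrAC subrr add0r.
  by rewrite rnormN.
by rewrite -[leRHS]k ler_wpM2r ?lerDl // ltW.
Qed.

Lemma bidual_oneP : is_bidual_one (bidual_one A).
Proof. exact: (xgetPex 0 (ex_intro _ _ unit_functional_one)). Qed.

Lemma bidual_act_one f : bidual_act (bidual_one A) f = f.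
Proof.
rewrite -[RHS]unit_functional_act; congr (bidual_act _ f).
exact: is_bidual_one_uniq bidual_oneP unit_functional_one.
Qed.

End BidualOne.

(** * Zero products *)

Section ZeroProducts.
Variables (R : realType) (A B : cstarAlgType R) (theta : {blin A -> B}).
Hypothesis theta_zp : forall a b : A, a ** b = 0 -> theta a ** theta b = 0.
Local Notation U := (unitz A).
Implicit Types (a b c h : A) (x y : U).

(** The arguments x and y range over the unitization, so 1 can be inserted although [A] may lack it,
    while a and c keep the arguments of [theta] in [A]. *)
Let Phi a c x y : B := theta (ract a x) ** theta (lact y c).

Let PhiDl a c x x' y : Phi a c (x + x') y = Phi a c x y + Phi a c x' y.
Proof. by rewrite /Phi ractD blin_add cmulDl. Qed.
Let PhiDr a c x y y' : Phi a c x (y + y') = Phi a c x y + Phi a c x y'.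
Proof. by rewrite /Phi lactD (blin_add theta (lact y c)) cmulDr. Qed.
Let PhiZl a c k x y : Phi a c (k *: x) y = k *: Phi a c x y.
Proof. by rewrite /Phi ractZ blin_scale cmulZl. Qed.
Let PhiZr a c k x y : Phi a c x (k *: y) = k *: Phi a c x y.
Proof. by rewrite /Phi lactZ (blin_scale theta k (lact y c)) cmulZr. Qed.
Let Phi_suml a c (I : finType) (P : pred I) (F : I -> U) y :
  Phi a c (\sum_(i | P i) F i) y = \sum_(i | P i) Phi a c (F i) y.
Proof.
have Phi0 : Phi a c 0 y = 0 by rewrite -(scale0r (1 : U)) PhiZl scale0r.
by apply: (big_morph (fun x => Phi a c x y)) => [x x'|]; rewrite ?PhiDl.
Qed.
Let Phi_sumr a c (I : finType) (P : pred I) (F : I -> U) x :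
  Phi a c x (\sum_(i | P i) F i) = \sum_(i | P i) Phi a c x (F i).
Proof.
have Phi0 : Phi a c x 0 = 0 by rewrite -(scale0r (1 : U)) PhiZr scale0r.
by apply: (big_morph (Phi a c x)) => [y y'|]; rewrite ?PhiDr.
Qed.
Let Phi_orth a c x y : x * y = 0 -> Phi a c x y = 0.
Proof.
move=> xy; apply: theta_zp.
by rewrite ract_lact -lactM xy /lact /= scale0r cmul0l addr0 cmul0r.
Qed.
Let Phi_norm a c x y : uN x <= 1 -> uN y <= 1 ->
  rnorm (Phi a c x y) <= rnorm theta ^+ 2 * (rnorm a * rnorm c).
Proof.
move=> x1 y1; apply: (le_trans (crnormM _ _)).
rewrite expr2 mulrACA ler_pM ?rnorm_ge0 // (le_trans (blin_rnorm_le _ _)) //;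
  rewrite ler_wpM2l ?rnorm_ge0 //.
  by rewrite (le_trans (uN_ract _ _)) // ler_piMl ?rnorm_ge0.
by rewrite (le_trans (uN_le _ _)) // ler_piMl ?rnorm_ge0.
Qed.

(** For indices at distance at most 1, the residues modulo 3 determine the signed difference; modulo
    2 the values 1 and -1 would be confused. *)
Let chi (r s : nat) : R :=
  if r == s then 0 else if r == (s.+1 %% 3)%N then 1 else -1.

Let chi_norm r s : `|chi r s| <= 1.
Proof.
rewrite /chi; case: ifP => _; first by rewrite normr0.
by case: ifP => _; rewrite ?normrN normr1.
Qed.

(* The hats split the identity into a sum of pieces [l i], any two of which are
   orthogonal unless their indices are adjacent.  So [i - j] can be replaced
   by [chi (i %% 3) (j %% 3)] in front of [Phi (l i) (l j)], which bounds
   [n] times the defect of the balance identity independently of [n]. *)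
Let balance_bound a c h n : cstar h = h -> rnorm h <= 2^-1 -> (0 < n)%N ->
  n%:R * rnorm (Phi a c (uemb h) 1 - Phi a c 1 (uemb h)) <=
  9 * (rnorm theta ^+ 2 * (rnorm a * rnorm c)).
Proof.
move=> hS h2 n0; set K := rnorm theta ^+ 2 * _.
(* [y] maps [-1, 1] onto [0, 2n], which has 2n + 1 integer nodes. The hats then resolve n (h + 1)
   instead of n h; the added constant cancels in the difference to be bounded. *)
pose m := (2 * n).+1; pose y (s : R) := n%:R * (s + 1).
have ybd (s : R) : `|s| <= 1 -> 0 <= y s <= (2 * n)%:R.
  rewrite ler_norml /y natrM => /andP[s1 s2].
  by rewrite mulr_ge0 //=; [rewrite mulrC ler_wpM2r //; lra | lra].
have /choice[l lE] (i : 'I_m) : exists x, calc h (fun s => hat i (y s)) x.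
  apply: (calc_exists hS h2); apply: (@lipschitz_poly_approx _ _ n%:R) => s u.
  apply: (le_trans (hat_lipschitz _ _ _)).
  by rewrite /y -mulrBr opprD addrACA subrr addr0 normrM normr_nat.
have sum1 : \sum_(i < m) l i = 1.
  apply: (calc_uniq hS h2 (calc_sum _ _ lE)).
  apply: calc_ext (@calc1 R A h) => s /ybd ys.
  by have [-> _] := sum_hat ys.
have sumi : \sum_(i < m) i%:R%:C *: l i = n%:R%:C *: (uemb h + 1).
  have iE (i : 'I_m) : calc h (fun s => i%:R * hat i (y s)) (i%:R%:C *: l i).
    exact: calcZ (lE i).
  apply: (calc_uniq hS h2 (calc_sum _ _ iE)).
  apply: calc_ext (calcZ n%:R (calcD (@calc_id R A h) (@calc1 R A h))) => s /ybd ys.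
  by have [_ ->] := sum_hat ys.
have orth (i j : 'I_m) : (i.+2 <= j)%N || (j.+2 <= i)%N -> l i * l j = 0.
  move=> ij; apply: (calc_uniq hS h2 (calcM (lE i) (lE j))).
  apply: calc_ext (@calc0 R A h) => s _.
  by case/orP: ij => ij; [rewrite hatM0 | rewrite mulrC hatM0].
pose g (i : 'I_m) : 'I_3 := inord (i %% 3).
have gE i : g i = (i %% 3)%N :> nat by rewrite inordK // ltn_pmod.
(* A coefficient that depends only on residues lets the double sum collapse to nine terms in the
   [La r]. Each of these is the value at h of a function between 0 and 1, hence has seminorm at most
   1. *)
pose La (r : 'I_3) : U := \sum_(i < m | g i == r) l i.
have LaN r : uN (La r) <= 1.
  apply: (calc_norm hS h2 (calc_sum _ _ lE)) => s /ybd ys.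
  rewrite ger0_norm; last by apply: sumr_ge0 => i _; exact: hat_ge0.
  have [s1 _] := sum_hat ys; rewrite -s1 [leRHS](bigID (fun i => g i == r)) /=.
  by rewrite lerDl; apply: sumr_ge0 => i _; exact: hat_ge0.
have key : n%:R%:C *: (Phi a c (uemb h) 1 - Phi a c 1 (uemb h)) =
    \sum_(r : 'I_3) \sum_(s : 'I_3) (chi r s)%:C *: Phi a c (La r) (La s).
  have -> : n%:R%:C *: (Phi a c (uemb h) 1 - Phi a c 1 (uemb h)) =
      Phi a c (n%:R%:C *: (uemb h + 1)) 1 - Phi a c 1 (n%:R%:C *: (uemb h + 1)).
    by rewrite PhiZl PhiZr -scalerBr PhiDl PhiDr opprD addrACA subrr addr0.
  rewrite -sumi -sum1 !Phi_suml.
  transitivity (\sum_(i < m) \sum_(j < m) (chi (g i) (g j))%:C *: Phi a c (l i) (l j)).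
    rewrite -sumrB; apply: eq_bigr => i _; rewrite !Phi_sumr -sumrB.
    apply: eq_bigr => j _; rewrite PhiZl PhiZr -scalerBl.
    have [/orth/Phi_orth -> | ] := boolP ((i.+2 <= j)%N || (j.+2 <= i)%N).
      by rewrite !scaler0.
    rewrite negb_or -!ltnNge !ltnS => /andP[ij ji]; congr (_ *: _).
    rewrite -rmorphB; congr (_%:C); rewrite /chi !gE.
    move: (nat_of_ord i) (nat_of_ord j) ij ji => p q pq qp.
    have : p = q \/ p = q.+1 \/ q = p.+1 by lia.
    move=> [->|[->|->]].
    - by rewrite eqxx subrr.
    - rewrite ifF; last by lia.
      by rewrite ifT; [rewrite -natr1; ring | lia].
    - rewrite ifF; last by lia.
      by rewrite ifF; [rewrite -natr1; ring | lia].
  rewrite (partition_big g xpredT) //=; apply: eq_bigr => r _.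
  under eq_bigr => i _ do rewrite (partition_big g xpredT) //=.
  rewrite exchange_big /=; apply: eq_bigr => s _.
  rewrite /La Phi_suml scaler_sumr; apply: eq_bigr => i /eqP ->.
  by rewrite Phi_sumr scaler_sumr; apply: eq_bigr => j /eqP ->.
have -> : n%:R * rnorm (Phi a c (uemb h) 1 - Phi a c 1 (uemb h)) =
    rnorm (n%:R%:C *: (Phi a c (uemb h) 1 - Phi a c 1 (uemb h))).
  by rewrite rnormZ rnorm_real normr_nat.
rewrite key (le_trans (rnorm_sum _ _ _)) //.
apply: (@le_trans _ _ (\sum_(r < 3) \sum_(s < 3) K)).
  apply: ler_sum => r _; apply: (le_trans (rnorm_sum _ _ _)).
  apply: ler_sum => s _; rewrite rnormZ rnorm_real.
  apply: (@le_trans _ _ (1 * K)); last by rewrite mul1r.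
  by apply: ler_pM; rewrite ?rnorm_ge0 ?chi_norm ?Phi_norm.
by rewrite !sumr_const !card_ord -mulrnA -[leLHS]mulr_natl.
Qed.

Lemma zero_product_balanced a b c :
  theta (a ** b) ** theta c = theta a ** theta (b ** c).
Proof.
move: b a c; apply: selfadjoint_span.
- move=> b b' hb hb' a c.
  by rewrite cmulDr cmulDl !blin_add cmulDl cmulDr hb hb'.
- by move=> k b hb a c; rewrite cmulZr cmulZl !blin_scale cmulZl cmulZr hb.
move=> h hS h2 a c; apply/subr0_eq/rnorm0_eq0/eqP.
have := fun n => @balance_bound a c h n hS h2.
rewrite /Phi !ract_emb !lact_emb ract1 lact1.
set D := rnorm _; set C := 9 * _ => DC.
have D0 : 0 <= D by exact: rnorm_ge0.
apply: contraT => Dn; have Dp : 0 < D by rewrite lt0r Dn.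
have := DC (Num.truncn (C / D)).+1 isT; rewrite -ler_pdivlMr //.
by rewrite leNgt truncnS_gt.
Qed.

End ZeroProducts.

(** * Automatic boundedness of multipliers *)

Section MultiplierBounded.
Variables (R : realType) (B : cstarAlgType R) (S : B -> B).
Hypothesis S_linear : linear S.
Hypothesis S_balanced : forall b b', S b ** b' = b ** S b'.

Let S0 : S 0 = 0.
Proof. by have := S_linear (-1) 0 0; rewrite scaler0 addr0 scaleN1r addNr. Qed.

Let SZ k b : S (k *: b) = k *: S b.
Proof. by have := S_linear k b 0; rewrite !addr0 S0 addr0. Qed.

Let unbounded_witness : ~ bounded_op S -> forall M : R, 0 <= M ->
  exists b, rnorm b <= 1 /\ M <= rnorm (S b).
Proof.
move=> unb M M0; apply: contrapT => nob; apply: unb; exists M => b.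
rewrite !rnormE -real_complexM lecR leNgt; apply/negP => lt.
have [b0|b0] := eqVneq (rnorm b) 0.
  by move: lt; rewrite (rnorm0_eq0 b0) S0 !rnorm0 mulr0 ltxx.
have bp : 0 < rnorm b by rewrite lt0r b0 rnorm_ge0.
apply: nob; exists ((rnorm b)^-1%:C *: b).
rewrite SZ !rnormZ rnorm_real ger0_norm ?invr_ge0 ?rnorm_ge0 // mulVf //.
by split=> //; rewrite mulrC ler_pdivlMr // ltW.
Qed.

(* The gliding hump proof of uniform boundedness, applied to the
   multiplications by [S b], [b] in the unit ball. *)
Lemma balanced_bounded : bounded_op S.
Proof.
apply: contrapT => /unbounded_witness unb.
(* With ratio 1/4 the moves after step n add up to at most r n / 3. Staying below r n / 2, they
   cannot undo more than half of the growth r n |S(b n)| gained at that step. *)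
pose r n : R := 4^-1 ^+ n.+1.
have r0 n : 0 < r n by rewrite exprn_gt0 // invr_gt0.
have rS n : r n = 4 * r n.+1 by rewrite /r [in RHS]exprS mulrA mulfV ?mul1r.
have /choice[b bP] n : exists b, rnorm b <= 1 /\ n%:R / r n <= rnorm (S b).
  by apply: unb; rewrite divr_ge0 // ltW.
(* For xi a multiple of s* the norm |s xi| is |s| |xi|. As s (x + xi) - s (x - xi) = 2 s xi, one of
   the two points x + xi and x - xi is far enough. *)
have move_away n x : exists x', rnorm (x' - x) <= r n /\
    r n * rnorm (S (b n)) <= rnorm (S (b n) ** x').
  set s := S (b n).
  have [s0|s0] := eqVneq (rnorm s) 0.
    by exists x; rewrite subrr rnorm0 s0 mulr0 rnorm_ge0 (ltW (r0 n)).
  pose xi := (r n / rnorm s)%:C *: cstar s.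
  have xin : rnorm xi = r n.
    rewrite rnormZ rnorm_real crnorm_star ger0_norm ?divr_ge0 ?rnorm_ge0 ?(ltW (r0 n)) //.
    by rewrite divfK.
  have sxi : rnorm (s ** xi) = r n * rnorm s.
    rewrite cmulZr rnormZ crnorm_mul_star rnorm_real.
    rewrite ger0_norm ?divr_ge0 ?rnorm_ge0 ?(ltW (r0 n)) //.
    by rewrite expr2 mulrA divfK.
  have := rnormB (s ** (x + xi)) (s ** (x - xi)).
  rewrite -cmulBr opprD opprK addrACA subrr add0r cmulDr -mulr2n -scaler_nat rnormZ.
  have -> : rnorm (2 : R[i]) = 2.
    by rewrite -[2 : R[i]](rmorph_nat (real_complex R)) rnorm_real normr_nat.
  rewrite sxi => h.
  have [h1|h1] := leP (r n * rnorm s) (rnorm (s ** (x + xi))).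
    by exists (x + xi); rewrite addrC addKr xin lexx.
  exists (x - xi); rewrite addrC addKr rnormN xin; split=> //; lra.
have /choice[F FP] (p : nat * B) := move_away p.1 p.2.
pose x := fix x n := if n is m.+1 then F (m, x m) else 0.
have xs n : rnorm (x n.+1 - x n) <= r n by have [] := FP (n, x n).
have xl n : r n * rnorm (S (b n)) <= rnorm (S (b n) ** x n.+1) by have [] := FP (n, x n).
have tail n k : rnorm (x (n.+1 + k)%N - x n.+1) <= r n / 3 - r (n + k)%N / 3.
  elim: k => [|k IH]; first by rewrite !addn0 !subrr rnorm0.
  apply: (le_trans (rnorm_triangle (x (n.+1 + k)%N) _ _)).
  rewrite !addnS; have := xs (n.+1 + k)%N; have := rS (n + k)%N.
  by rewrite addSn; move: IH; rewrite addSn; lra.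
have [n|l xlim] := @rnorm_geometric_limit R B x 1.
  apply: (le_trans (xs n)); rewrite mul1r /r lerXn2r ?nnegrE ?invr_ge0 //.
  by rewrite lef_pV2 ?posrE // ler_nat.
have close n : rnorm (x n.+1 - l) <= r n / 2.
  have [|N hN] := @half_expn_small R 1 (r n / 6); first by rewrite divr_gt0.
  apply: (le_trans (rnorm_triangle (x (n.+1 + N)%N) _ _)).
  have := tail n N; rewrite rnorm_distC; have := xlim (n.+1 + N)%N.
  by have := hN (n.+1 + N)%N (leq_addl _ _); have := r0 (n + N)%N; lra.
have big n : n%:R <= 2 * rnorm (S l).
  have [bn Sn] := bP n.
  (* Balance supplies the pointwise bound: S(b n) l = b n S(l) with b n in the unit ball. The hump
     makes the same product at least n / 2. *)
  have h1 : rnorm (S (b n) ** l) <= rnorm (S l).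
    by rewrite S_balanced (le_trans (crnormM _ _)) // ler_piMl ?rnorm_ge0.
  have h2 := crnormM (S (b n)) (x n.+1 - l).
  have h3 := rnormD (S (b n) ** (x n.+1 - l)) (S (b n) ** l).
  rewrite -cmulDr subrK in h3.
  have h4 : rnorm (S (b n)) * rnorm (x n.+1 - l) <= rnorm (S (b n)) * (r n / 2).
    by rewrite ler_wpM2l ?rnorm_ge0 ?close.
  move: Sn; rewrite ler_pdivrMr //; have := xl n; move: h1 h2 h3 h4.
  by move: (rnorm (S (b n))) => s; lra.
have := big (Num.truncn (2 * rnorm (S l))).+1.
by rewrite leNgt truncnS_gt.
Qed.

End MultiplierBounded.

Section ArensTheory.
Variables (R : realType) (A : cstarAlgType R).
Implicit Types (a b : A) (g : dual A) (F G : bidual A).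

Lemma arens_dual_act F G g a :
  arens F G (dual_act g a) = bidual_act F (bidual_act G g) a.
Proof.
rewrite /=; congr (F _); apply: blinP => b /=; congr (G _); apply: blinP => c /=.
by rewrite cmulA.
Qed.

(** By F = 1 F, the value of F at g is that of 1 at F.g, and F.g only involves the numbers F(g.a).
    Identities in the bidual can thus be tested on elements of the algebra. *)
Lemma bidual_ext F G :
  (forall g a, F (dual_act g a) = G (dual_act g a)) -> F = G.
Proof.
move=> FG; have [<- _] := bidual_oneP F; have [<- _] := bidual_oneP G.
by apply: blinP => g /=; congr (_ _); apply: blinP => a; exact: FG.
Qed.

Lemma bidual_one_right g a : bidual_one A (bidual_act (to_bidual a) g) = g a.
Proof. by have [/(congr1 (fun F : bidual A => F g))] := bidual_oneP (to_bidual a). Qed.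

Lemma bidual_one_left g a : bidual_one A (dual_act g a) = g a.
Proof. by have := congr1 (fun f : dual A => f a) (bidual_act_one g). Qed.

End ArensTheory.

(** * The central multiplier theta(1) as a map of B *)

Section ZeroProductSurjection.
Variables (R : realType) (A B : cstarAlgType R) (theta : {blin A -> B}).
Hypothesis theta_surj : forall b : B, exists a : A, theta a = b.
Hypothesis theta_zp : forall a b : A, a ** b = 0 -> theta a ** theta b = 0.
Implicit Types (a c d : A) (b w : B).

Let bal := zero_product_balanced theta_zp.

(** Both sides equal theta(c1) theta(c2 d1) theta(d2), by balancing once on each side. This is what
    makes the passage from theta(ab) to theta(a) theta(b) well defined. *)
Let theta_mul4 c1 c2 d1 d2 :
  (theta c1 ** theta c2) ** theta (d1 ** d2) =
  theta (c1 ** c2) ** (theta d1 ** theta d2).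
Proof. by rewrite -!cmulA -bal !cmulA -bal. Qed.

Let cmul_suml (C : cstarAlgType R) (I : Type) (s : seq I) (f : I -> C) (b : C) :
  (\sum_(i <- s) f i) ** b = \sum_(i <- s) (f i ** b).
Proof. by apply: (big_morph (fun x => x ** b)) => [x y|]; rewrite ?cmulDl ?cmul0l. Qed.
Let cmul_sumr (C : cstarAlgType R) (I : Type) (s : seq I) (f : I -> C) (b : C) :
  b ** (\sum_(i <- s) f i) = \sum_(i <- s) (b ** f i).
Proof. by apply: (big_morph (fun x => b ** x)) => [x y|]; rewrite ?cmulDr ?cmul0r. Qed.
Let theta_sum (I : Type) (s : seq I) (f : I -> A) :
  theta (\sum_(i <- s) f i) = \sum_(i <- s) theta (f i).
Proof. by apply: (big_morph theta) => [x y|]; rewrite ?blin_add ?blin_zero. Qed.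

(* [shift b w] says that [w = theta(1) b], without mentioning [theta(1)]. *)
Let shift b w : Prop :=
  forall d1 d2, w ** theta (d1 ** d2) = b ** (theta d1 ** theta d2).

(** By surjectivity and factorization the elements theta(d1 d2) span [B], so w - w' annihilates [B]
    from the left. *)
Let shift_uniq b w w' : shift b w -> shift b w' -> w = w'.
Proof.
move=> bw bw'; apply/subr0_eq/cmul_left_faithful => b'.
have [c <-] := theta_surj b'; have [s ->] := factorization c.
rewrite theta_sum cmul_sumr big1 // => p _.
by rewrite cmulBl bw bw' subrr.
Qed.

Let shift_exists b : exists w, shift b w.
Proof.
have [c <-] := theta_surj b; have [s ->] := factorization c.
exists (\sum_(p <- s) theta p.1 ** theta p.2) => d1 d2.
rewrite theta_sum !cmul_suml; apply: eq_bigr => p _; exact: theta_mul4.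
Qed.

(* Left multiplication by [theta(1)] and its inverse. *)
Lemma central_multiplier_pair : exists T S : B -> B,
  [/\ linear S, cancel T S & cancel S T] /\
  [/\ forall b b', T b ** b' = b ** T b', forall b b', T (b ** b') = T b ** b',
      forall b b', S b ** b' = b ** S b' &
      forall a a', theta a ** S (theta a') = theta (a ** a')].
Proof.
have /choice[T TP] := shift_exists.
have Tlin : linear T.
  move=> k b b'; apply: (@shift_uniq (k *: b + b')); first exact: TP.
  by move=> d1 d2; rewrite !cmulDl !cmulZl TP TP.
have T0 : T 0 = 0 by have := Tlin (-1) 0 0; rewrite scaler0 addr0 scaleN1r addNr.
have TD b b' : T (b + b') = T b + T b' by rewrite -[b]scale1r Tlin !scale1r.
have TB b b' : T (b - b') = T b - T b'.
  by rewrite addrC -scaleN1r Tlin scaleN1r addrC.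
have Ttheta c1 c2 : T (theta (c1 ** c2)) = theta c1 ** theta c2.
  by apply: (@shift_uniq (theta (c1 ** c2))); [exact: TP | exact: theta_mul4].
have Tsum (I : Type) (s : seq I) (f : I -> B) :
    T (\sum_(i <- s) f i) = \sum_(i <- s) T (f i).
  exact: (big_morph T TD T0).
have Tbal b b' : T b ** b' = b ** T b'.
  have [c <-] := theta_surj b'; have [s ->] := factorization c.
  rewrite theta_sum Tsum !cmul_sumr; apply: eq_bigr => p _.
  by rewrite TP Ttheta.
have TM b b' : T (b ** b') = T b ** b'.
  apply: (@shift_uniq (b ** b')); first exact: TP.
  by move=> d1 d2; rewrite Tbal -cmulA TP cmulA.
(* Products theta(c1) theta(c2) span [B] and are values of T, so b T(b'') = T(b) b'' = 0 says that b
   annihilates [B]. *)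
have Tinj b : T b = 0 -> b = 0.
  move=> Tb; apply: cmul_left_faithful => b'.
  have [s ->] := factorization b'; rewrite cmul_sumr big1 // => p _.
  have [c1 <-] := theta_surj p.1; have [c2 <-] := theta_surj p.2.
  by rewrite -Ttheta -Tbal Tb cmul0l.
have /choice[S TS] b : exists w, T w = b.
  have [s ->] := factorization b.
  have /choice[f fP] (p : B * B) : exists w, T w = p.1 ** p.2.
    have [c1 <-] := theta_surj p.1; have [c2 <-] := theta_surj p.2.
    by exists (theta (c1 ** c2)).
  by exists (\sum_(p <- s) f p); rewrite Tsum; apply: eq_bigr => p _.
have ST : cancel T S by move=> b; apply/subr0_eq/Tinj; rewrite TB TS subrr.
exists T, S; split; split=> //.
- by move=> k b b'; apply: (can_inj ST); rewrite Tlin !TS.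
- by move=> b b'; rewrite -{1}(TS b') -Tbal TS.
(* Comparison after T: the left side becomes theta(a) T(S(theta(a'))) = theta(a) theta(a'), which is
   T(theta(aa')). *)
- move=> a a'; apply: (can_inj ST).
  by rewrite Ttheta TM Tbal TS.
Qed.

End ZeroProductSurjection.

Theorem theorem2p5 (R : realType) (A B : cstarAlgType R)
    (theta : {blin A -> B})
    (theta_surj : forall b : B, exists a : A, theta a = b)
    (theta_zp : forall a b : A, a ** b = 0 -> theta a ** theta b = 0) :
  let theta1 : bidual B := bitranspose theta (bidual_one A) in
  [/\ multiplier_algebra B theta1,
      forall x : bidual B, multiplier_algebra B x ->
        arens theta1 x = arens x theta1,
      exists y : bidual B,
        [/\ multiplier_algebra B y,
            arens theta1 y = bidual_one B & arens y theta1 = bidual_one B] &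
      exists phi : {linear A -> B},
        [/\ forall a b : A, phi (a ** b) = phi a ** phi b,
            forall b : B, exists a : A, phi a = b &
            forall a : A,
              to_bidual (theta a) = arens theta1 (to_bidual (phi a))]].
Proof.
move=> theta1.
have [T [S [[Slin TK SK] [Tbal TM Sbal thetaS]]]] :=
  central_multiplier_pair theta_surj theta_zp.
pose Sop : {blin B -> B} := BLin Slin (balanced_bounded Slin Sbal).
have phi_onto b : exists c, S (theta c) = b.
  by have [c cE] := theta_surj (T b); exists c; rewrite cE TK.
have SM b b' : S (b ** b') = S b ** b'.
  by apply: (can_inj TK); rewrite TM !SK.
(* Write b = S(theta(c)). Then g(b theta(x)) = g(theta(c) S(theta(x))) = g(theta(c x)), so the
   functional to which 1 is applied is (g o theta).c, and 1 takes the value g(theta(c)) = g(T b)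
   there. *)
have theta1_act g b : bidual_act theta1 g b = g (T b).
  have [c <-] := phi_onto b; rewrite SK.
  rewrite -[RHS]/(transpose_dual theta g c) -(bidual_one_left (transpose_dual theta g)).
  rewrite -[LHS]/(bidual_one A (transpose_dual theta (dual_act g (S (theta c))))).
  by congr (blin_fun _ _); apply: blinP => x /=; rewrite Sbal thetaS.
have theta1_left g b : theta1 (bidual_act (to_bidual b) g) = g (T b).
  have [c <-] := phi_onto b; rewrite SK.
  rewrite -[RHS]/(transpose_dual theta g c) -(bidual_one_right (transpose_dual theta g)).
  rewrite -[LHS]/(bidual_one A (transpose_dual theta
    (bidual_act (to_bidual (S (theta c))) g))).
  by congr (blin_fun _ _); apply: blinP => x /=; rewrite thetaS.
have mul_left b : arens theta1 (to_bidual b) = to_bidual (T b).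
  by apply: blinP => g; exact: theta1_left.
have mul_right b : arens (to_bidual b) theta1 = to_bidual (T b).
  by apply: blinP => g; exact: theta1_act.
(* The candidate inverse is S**(1), just as theta(1) is theta**(1); it acts on [B] as S does. *)
pose y : bidual B := bitranspose Sop (bidual_one B).
have y_act g b : bidual_act y g b = g (S b).
  rewrite -(bidual_one_left g).
  rewrite -[LHS]/(bidual_one B (transpose_dual Sop (dual_act g b))).
  by congr (blin_fun _ _); apply: blinP => x /=; rewrite Sbal.
have y_left g b : y (bidual_act (to_bidual b) g) = g (S b).
  rewrite -(bidual_one_right g).
  rewrite -[LHS]/(bidual_one B (transpose_dual Sop (bidual_act (to_bidual b) g))).
  by congr (blin_fun _ _); apply: blinP => x /=; rewrite Sbal.
split.
- by move=> b; split; [exists (T b) | exists (T b)].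
(* At g.a, theta(1) x gives x(g.(T a)) and x theta(1) gives x((theta(1).g).a); the two functionals
   agree at b since T(a b) = T(a) b. *)
- move=> x _; apply: bidual_ext => g a; rewrite !arens_dual_act theta1_act /=.
  congr (x _); apply: blinP => b.
  by rewrite -[RHS]/(bidual_act theta1 g (a ** b)) theta1_act TM.
- exists y; split.
  + move=> b; split; exists (S b) => //; apply: blinP => g.
      exact: esym (y_left g b).
    exact: esym (y_act g b).
  + apply: bidual_ext => g a.
    by rewrite arens_dual_act theta1_act y_act TK bidual_one_left.
  + apply: bidual_ext => g a.
    by rewrite arens_dual_act y_act theta1_act SK bidual_one_left.
- pose phi : {linear A -> B} := (Sop \o theta : A -> B).
  exists phi; split=> [a b|b|a].
  + by rewrite /= -thetaS SM.
  + exact: phi_onto.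
  + by rewrite mul_left /= SK.
Qed.
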